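(* The family $\mathcal F((\text{2CC})^c)=\{((\text{2CC})^c)_n\}_{n\ge2}$ is a complete and universal family for $\Pi_2^p$.
   Context: $\text{2CC}$ is the set of finite simple graphs (structures over $\sigma_g=\langle E^2\rangle$, universe $\{0,\dots,m-1\}$, $E$ symmetric and irreflexive) admitting a 2-coloring of the vertices with no monochromatic maximal clique; $(\text{2CC})^c$ is the set of simple graphs admitting no such coloring. For a problem $S$ over $\sigma$, $S_n:=S\cup\{\mathcal A\in\mathrm{STRUC}[\sigma]:\|\mathcal A\|<n\}$ and $\mathcal F(S)=\{S_n\}_{n\ge2}$. $\Pi_2^p$ is the class of problems MOD$[\neg\Phi]$ with $\Phi$ of the form $\exists\vec R_1\forall\vec R_2\,\varphi$, $\varphi$ first order (numeric symbols $\le$, BIT, PLUS, TIMES, SUC, $0,1,\max$ available with standard meaning). Completeness is with respect to first-order projections (fops): first-order interpretations whose universe formula is numeric and whose defining formulas have the form $\alpha_0\vee(\alpha_1\wedge\lambda_1)\vee\dots\vee(\alpha_\ell\wedge\lambda_\ell)$ with $\alpha_t$ numeric mutually exclusive and $\lambda_t$ literals of the input vocabulary; $B$ is $\Pi_2^p$-complete if $B\in\Pi_2^p$ and every $A\in\Pi_2^p$ reduces to $B$ by a fop. Universality: a conjunction $\bigwedge_{j=1}^tL_j(u_j,v_j)$ with $L_j\in\{E,\neg E\}$, $u_j,v_j\in\{0,\dots,m-1\}$, is $m$-consistent if some simple graph on $\{0,\dots,m-1\}$ satisfies it, and $m$-consistent in $S$ if some member of $S$ of size $m$ does; $S$ is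 $(n,t)$-universal if for all $m\ge n$ every $m$-consistent such conjunction of $t$ literals is $m$-consistent in $S$. A family $\mathcal F$ over $\sigma$ is complete and universal for $\mathbf C$ if (1) every member is $\mathbf C$-complete and (2) there are a sequence $\{n_k\}_{k\ge0}$ and a natural number $m$ such that for every $k\ge m$ some $(n_k,k)$-universal problem in $\mathcal F$ contains all $\sigma$-structures of size less than $n_k$. *)

(* Defs.v *)
From mathcomp Require Export all_boot all_order.
From mathcomp Require Export classical_sets.

Set Implicit Arguments.
Unset Strict Implicit.
Unset Printing Implicit Defensive.

Local Open Scope classical_set_scope.

Record relsig := RelSig { rsym : finType; arity : rsym -> nat }.

Record vocab := Vocab { rels : relsig; csts : finType }.

Definition relint (s : relsig) (n : nat) : Type :=
  forall R : rsym s, (arity R).-tuple 'I_n -> bool.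

(* Structures have at least two elements, so that the numeric constants 0 and
   1 are distinct and every structure has an element named 1. *)
Record STRUC (sigma : vocab) := Struc {
  usize : nat;
  usize_gt1 : 1 < usize;
  relv : relint (rels sigma) usize;
  cstv : csts sigma -> 'I_usize }.

Notation problem sigma := (set (STRUC sigma)).

(* [V] is the type of free variables; a quantifier binds [None]. *)
Inductive term (sigma : vocab) (V : Type) : Type :=
| Var of V
| Cst of csts sigma
| Zero
| One
| Max.

Inductive fo (sigma : vocab) (V : Type) : Type :=
| Eq of term sigma V & term sigma V
| Le of term sigma V & term sigma V
| Bit of term sigma V & term sigma V
| Plus of term sigma V & term sigma V & term sigma V
| Times of term sigma V & term sigma V & term sigma V
| Suc of term sigma V & term sigma V
| Rel (R : rsym (rels sigma)) of (arity R).-tuple (term sigma V)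
| Not of fo sigma V
| And of fo sigma V & fo sigma V
| Or of fo sigma V & fo sigma V
| Ex of fo sigma (option V)
| All of fo sigma (option V).

Section Semantics.
Variables (sigma : vocab) (A : STRUC sigma).
Local Notation U := 'I_(usize A).

Definition zeroU : U := Ordinal (ltnW (usize_gt1 A)).
Definition oneU : U := Ordinal (usize_gt1 A).

Lemma maxU_subproof : (usize A).-1 < usize A.
Proof. by rewrite ltn_predL (ltnW (usize_gt1 A)). Qed.

Definition maxU : U := Ordinal maxU_subproof.

Definition teval (V : Type) (e : V -> U) (t : term sigma V) : U :=
  match t with
  | Var v => e v
  | Cst c => cstv A c
  | Zero => zeroU
  | One => oneU
  | Max => maxU
  end.

Definition econs (V : Type) (x : U) (e : V -> U) (o : option V) : U :=
  if o is Some v then e v else x.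

(* BIT(i, j): the bit of weight 2 ^ j of i is 1. *)
Fixpoint sat (V : Type) (phi : fo sigma V) : (V -> U) -> bool :=
  match phi with
  | Eq s t => fun e => teval e s == teval e t
  | Le s t => fun e => teval e s <= teval e t
  | Bit s t => fun e => odd (teval e s %/ 2 ^ teval e t)
  | Plus s t u => fun e => teval e s + teval e t == teval e u :> nat
  | Times s t u => fun e => teval e s * teval e t == teval e u :> nat
  | Suc s t => fun e => (teval e s).+1 == teval e t :> nat
  | Rel R ts => fun e => relv [tuple of map (teval e) ts]
  | Not f => fun e => ~~ sat f e
  | And f g => fun e => sat f e && sat g e
  | Or f g => fun e => sat f e || sat g e
  | Ex f => fun e => [exists x : U, sat f (econs x e)]
  | All f => fun e => [forall x : U, sat f (econs x e)]
  end.

End Semantics.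

(* Numeric formulas are the formulas over the vocabulary with no symbols; their
   truth depends only on the size of the universe. *)
Definition vocab0 : vocab := Vocab (@RelSig void (of_void nat)) void.

Definition struc0 n (n_gt1 : 1 < n) : STRUC vocab0 :=
  @Struc vocab0 n n_gt1 (fun R : void => match R with end) (of_void 'I_n).

Definition numeric (V : Type) : Type := fo vocab0 V.

Definition nsat n (n_gt1 : 1 < n) (V : Type) (alpha : numeric V)
    (e : V -> 'I_n) : bool :=
  @sat vocab0 (struc0 n_gt1) V alpha e.

Definition sumsig (s1 s2 : relsig) : relsig :=
  @RelSig (rsym s1 + rsym s2)%type
    (fun R => match R with inl R1 => arity R1 | inr R2 => arity R2 end).

Definition extend (sigma : vocab) (s : relsig) : vocab :=
  Vocab (sumsig (rels sigma) s) (csts sigma).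

Definition expand (sigma : vocab) (A : STRUC sigma) (s : relsig)
    (X : relint s (usize A)) : STRUC (extend sigma s) :=
  @Struc (extend sigma s) (usize A) (usize_gt1 A)
    (fun R : rsym (sumsig (rels sigma) s) =>
       match R return (@arity (sumsig (rels sigma) s) R).-tuple 'I_(usize A)
                      -> bool with
       | inl R1 => @relv sigma A R1
       | inr R2 => @X R2
       end)
    (@cstv sigma A).

(* Second-order sentences of the form exists R1, forall R2, matrix. *)
Record sosent (sigma : vocab) := SOSent {
  exrels : relsig;
  allrels : relsig;
  matrix : fo (extend (extend sigma exrels) allrels) void }.

Definition models (sigma : vocab) (A : STRUC sigma) (Phi : sosent sigma)
    : Prop :=
  exists X : relint (exrels Phi) (usize A),
  forall Y : relint (allrels Phi) (usize A),
    sat (A := expand (A := expand X) Y) (matrix Phi) (of_void 'I_(usize A)).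

Definition complexity_class : Type := forall sigma : vocab, set (problem sigma).

Definition Pi2p : complexity_class := fun sigma =>
  [set S : problem sigma |
    exists Phi : sosent sigma, S = [set A | ~ models A Phi]].

(* Arguments of literals: a variable or an input constant symbol. *)
Definition larg (sigma : vocab) (V : Type) : Type := (V + csts sigma)%type.

Inductive latom (sigma : vocab) (V : Type) : Type :=
| LEq of larg sigma V & larg sigma V
| LRel (R : rsym (rels sigma)) of (arity R).-tuple (larg sigma V).

(* The literal is positive if [lsign] is [true], negated otherwise. *)
Record literal (sigma : vocab) (V : Type) := Literal {
  lsign : bool;
  lat : latom sigma V }.

Definition largval (sigma : vocab) (A : STRUC sigma) (V : Type)
    (e : V -> 'I_(usize A)) (a : larg sigma V) : 'I_(usize A) :=
  match a with inl v => e v | inr c => cstv A c end.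

Definition lsat (sigma : vocab) (A : STRUC sigma) (V : Type)
    (l : literal sigma V) (e : V -> 'I_(usize A)) : bool :=
  lsign l == match lat l with
             | LEq a b => largval e a == largval e b
             | LRel R args => relv [tuple of map (largval e) args]
             end.

(* alpha_0 \/ (alpha_1 /\ lambda_1) \/ ... \/ (alpha_l /\ lambda_l) *)
Record pform (sigma : vocab) (V : Type) := PForm {
  alpha0 : numeric V;
  cases : seq (numeric V * literal sigma V) }.

Definition psat (sigma : vocab) (A : STRUC sigma) (V : Type)
    (p : pform sigma V) (e : V -> 'I_(usize A)) : bool :=
  nsat (usize_gt1 A) (alpha0 p) e ||
  has (fun c => nsat (usize_gt1 A) c.1 e && lsat c.2 e) (cases p).

Definition exclusive (sigma : vocab) (V : Type) (p : pform sigma V) : Prop :=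
  forall n (n_gt1 : 1 < n) (e : V -> 'I_n),
    pairwise (fun a b => ~~ (nsat n_gt1 a e && nsat n_gt1 b e))
             (alpha0 p :: unzip1 (cases p)).

Definition fop_dom k (phi0 : numeric 'I_k) n (n_gt1 : 1 < n)
    : {pred k.-tuplelexi 'I_n} :=
  fun b => nsat n_gt1 phi0 (tnth b).

(* [Order.enum_val] lists the tuples of the new universe in lexicographic
   order, which renames them as 0, 1, ... The variable [(i, j)] stands for the
   j-th coordinate of the i-th argument. *)
Definition fop_env k (phi0 : numeric 'I_k) n (n_gt1 : 1 < n) a
    (args : a.-tuple 'I_#|fop_dom phi0 n_gt1|) (ij : 'I_a * 'I_k) : 'I_n :=
  tnth (Order.enum_val (tnth args ij.1)) ij.2.

Record fop (sigma tau : vocab) := Fop {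
  fdim : nat;
  funiv : numeric 'I_fdim;
  frel : forall R : rsym (rels tau), pform sigma ('I_(arity R) * 'I_fdim);
  fcst : csts tau -> pform sigma 'I_fdim;
  funiv_gt1 : forall n (n_gt1 : 1 < n), 1 < #|fop_dom funiv n_gt1|;
  frel_exclusive : forall R, exclusive (frel R);
  fcst_exclusive : forall c, exclusive (fcst c);
  fcst_uniq : forall (A : STRUC sigma) (c : csts tau),
    exists! i : 'I_#|fop_dom funiv (usize_gt1 A)|,
      psat (A := A) (fcst c) (tnth (Order.enum_val i)) }.

Lemma fcst_ex (sigma tau : vocab) (I : fop sigma tau) (A : STRUC sigma)
    (c : csts tau) :
  exists i : 'I_#|fop_dom (funiv I) (usize_gt1 A)|,
    psat (A := A) (fcst I c) (tnth (Order.enum_val i)).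
Proof. by have [i [Hi _]] := fcst_uniq I A c; exists i. Qed.

Definition fop_map (sigma tau : vocab) (I : fop sigma tau) (A : STRUC sigma)
    : STRUC tau :=
  @Struc tau #|fop_dom (funiv I) (usize_gt1 A)| (funiv_gt1 I (usize_gt1 A))
    (fun R args => psat (A := A) (frel I R) (fop_env args))
    (fun c => xchoose (fcst_ex I A c)).

Definition fop_reducible (sigma tau : vocab) (S : problem sigma)
    (T : problem tau) : Prop :=
  exists I : fop sigma tau, forall A : STRUC sigma, S A <-> T (fop_map I A).

Definition complete (C : complexity_class) (tau : vocab) (T : problem tau)
    : Prop :=
  C tau T /\
  forall (sigma : vocab) (S : problem sigma), C sigma S -> fop_reducible S T.

Definition trunc (sigma : vocab) (S : problem sigma) (n : nat)
    : problem sigma :=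
  S `|` [set A | usize A < n].

Definition truncfam (sigma : vocab) (S : problem sigma)
    : set (problem sigma) :=
  [set trunc S n | n in [set n | 2 <= n]].

Definition sigma_g : vocab :=
  Vocab (@RelSig unit (fun=> 2)) void.

Definition edge (G : STRUC sigma_g) : rel 'I_(usize G) :=
  fun u v => @relv sigma_g G tt [tuple u; v].

Definition simple_graph : problem sigma_g :=
  [set G | symmetric (@edge G) /\ irreflexive (@edge G)].

Definition is_clique (G : STRUC sigma_g) (K : {set 'I_(usize G)}) : bool :=
  [forall u in K, forall v in K, (u != v) ==> edge u v].

(* Maximal cliques with a single vertex (isolated vertices) count: they are
   always monochromatic. *)
Definition two_clique_coloring (G : STRUC sigma_g)
    (c : 'I_(usize G) -> bool) : Prop :=
  forall K : {set 'I_(usize G)}, maxset (@is_clique G) K ->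
    ~ exists b : bool, forall v, v \in K -> c v = b.

Definition TwoCC : problem sigma_g :=
  [set G | simple_graph G /\ exists c, @two_clique_coloring G c].

Definition TwoCCc : problem sigma_g :=
  [set G | simple_graph G /\ ~ exists c, @two_clique_coloring G c].

(* A conjunction of t literals; [(b, u, v)] is E(u, v) if [b] is [true] and
   ~ E(u, v) otherwise. *)
Definition conj_lits (m t : nat) : Type := t.-tuple (bool * 'I_m * 'I_m).

Definition holds_in (m t : nat) (L : conj_lits m t) (m_gt1 : 1 < m)
    (E : relint (rels sigma_g) m) : bool :=
  all (fun l : bool * 'I_m * 'I_m =>
         let: (b, u, v) := l in
         @edge (@Struc sigma_g m m_gt1 E (of_void _)) u v == b) L.

Definition consistent_in (S : problem sigma_g) (m t : nat)
    (L : conj_lits m t) : Prop :=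
  exists (m_gt1 : 1 < m) (E : relint (rels sigma_g) m),
    S (@Struc sigma_g m m_gt1 E (of_void _)) /\ holds_in L m_gt1 E.

Definition consistent (m t : nat) (L : conj_lits m t) : Prop :=
  consistent_in simple_graph L.

Definition universal (n t : nat) (S : problem sigma_g) : Prop :=
  forall m, n <= m ->
  forall L : conj_lits m t, consistent L -> consistent_in S L.

Definition complete_universal (C : complexity_class)
    (F : set (problem sigma_g)) : Prop :=
  (forall S, F S -> complete C S) /\
  exists (n_ : nat -> nat) (m : nat), forall k, m <= k ->
    exists S, [/\ F S, universal (n_ k) k S &
                  forall A : STRUC sigma_g, usize A < n_ k -> S A].

(* Main.v *)
Require Import Defs.
From mathcomp Require Import boolp fintype finset.

(* Hardness.  Write the matrix of a sentence [exists X, forall Y, phi] with the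
   single connective ~ exists x, f \/ g, and consider the nodes (subformula,
   environment).  Each node is a group of pairwise non-adjacent vertices: one
   blue vertex, adjacent to all other groups, and red vertices claiming a truth
   value of the node, with a true child as witness when the value is false;
   claims that contradict each other locally are not adjacent.  A further group
   is entirely red.  Hence a monochromatic maximal clique is red and is a full
   consistent evaluation of [phi], in which the atoms of [Y] are chosen freely;
   the root is only allowed the value false.  The claims on atoms of [X] or of
   the input are red exactly when they hold: maximal cliques with two vertices
   force differences of colours and transmit to them the colours of vertices
   standing for these atoms.  So the 2-clique-colourings are the [X] for which
   no [Y] falsifies [phi].  Only the edges giving the colours of the input
   atoms depend on the input, each on a single literal.

   Universality.  An isolated vertex is a monochromatic maximal clique. *)

Set Implicit Arguments.
Unset Strict Implicit.
Unset Printing Implicit Defensive.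

(** * Maximal cliques *)

(** Maximality is asked at every vertex, members of [K] included: for an irreflexive [r] a member is
    its own non-neighbour. This form is first order in [K]. *)
Definition mclique (T : finType) (r : rel T) (K : {set T}) : Prop :=
  {in K &, forall u v, u != v -> r u v} /\
  forall v, exists2 u, u \in K & ~~ r v u.

Definition clique_colorable (T : finType) (r : rel T) : Prop :=
  exists c : T -> bool, forall K, mclique r K ->
  exists u v, [/\ u \in K, v \in K & c u != c v].

Lemma maxset_mclique (G : STRUC sigma_g) (K : {set 'I_(usize G)}) :
  simple_graph G -> maxset (@is_clique G) K <-> mclique (@edge G) K.
Proof.
move=> [Gsym Girr]; have cliqueP (L : {set 'I_(usize G)}) :
    reflect {in L &, forall u v, u != v -> edge u v} (is_clique L).
  apply: (iffP 'forall_implyP) => [LP u v Lu Lv uv|LP u Lu].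
    by have /'forall_implyP/(_ v Lv)/implyP := LP u Lu; apply.
  by apply/'forall_implyP => v Lv; apply/implyP; apply: LP.
split=> [/maxsetP[/cliqueP cK maxK]|[cK maxK]].
  split=> // v; apply/exists_inP; apply: contraT => /exists_inPn vP.
  have adjv u : u \in K -> edge v u by move=> /vP/negPn.
  (* A vertex adjacent to all of [K] joins [K] by maximality and is then adjacent to itself. *)
  have vK : v \in K.
    suff cvK : is_clique (v |: K) by rewrite -(maxK _ cvK) ?setU11 ?subsetUr.
    apply/cliqueP => x y /setU1P[->|xK] /setU1P[->|yK]; rewrite ?eqxx //.
    - by move=> _; apply: adjv.
    - by move=> _; rewrite Gsym; apply: adjv.
    - exact: cK.
  by have := adjv v vK; rewrite Girr.
apply/maxsetP; split=> [|L /cliqueP cL KL]; first exact/cliqueP.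
apply/eqP; rewrite eqEsubset KL andbT; apply/subsetP => v vL.
have [u uK] := maxK v; apply: contraNT => vK; apply: cL => //.
  exact: (subsetP KL).
by apply: contraNneq vK => ->.
Qed.

Lemma two_clique_coloringE (G : STRUC sigma_g) : simple_graph G ->
  (exists c, @two_clique_coloring G c) <-> clique_colorable (@edge G).
Proof.
move=> simG; split=> -[c cP]; exists c => K /(maxset_mclique K simG) mK.
  have : ~~ [forall b, [exists v in K, c v != b]] = false.
    apply/negPn/forallP => b; rewrite -negb_forall_in; apply/negP.
    by move=> /forall_inP mono; apply: (cP K mK); exists b => v /mono /eqP.
  move=> /negbFE/forallP bP.
  have /exists_inP[u uK cu] := bP true; have /exists_inP[v vK cv] := bP false.
  exists u, v; split=> //; by case: (c u) (c v) cu cv => [] [].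
move=> [b mono]; have [u [v [uK vK]]] := cP K mK.
by rewrite !mono ?eqxx.
Qed.

(* Non-adjacent copies of a vertex are interchangeable in maximal cliques. *)
Lemma clique_colorable_blowup (T T' : finType) (r : rel T) (r' : rel T')
    (h : T -> T') (s : T' -> T) :
  cancel s h -> irreflexive r' -> (forall u v, r u v = r' (h u) (h v)) ->
  clique_colorable r <-> clique_colorable r'.
Proof.
move=> sK irr rE; split=> -[c cP].
  exists (c \o s) => K [cK maxK].
  have [|u [v [/imsetP[x xK ->] /imsetP[y yK ->] cuv]]] := cP (s @: K).
    split=> [_ _ /imsetP[x xK ->] /imsetP[y yK ->] xy|v].
      by rewrite rE !sK cK //; apply: contraNneq xy => ->.
    have [u uK nvu] := maxK (h v).
    by exists (s u); rewrite ?imset_f // rE sK.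
  by exists x, y.
exists (c \o h) => K [cK maxK].
have [|_ [_ [/imsetP[x xK ->] /imsetP[y yK ->] cuv]]] := cP (h @: K).
  split=> [_ _ /imsetP[x xK ->] /imsetP[y yK ->] xy|v].
    by rewrite -rE cK //; apply: contraNneq xy => ->.
  have [u uK nvu] := maxK (s v).
  by exists (h u); rewrite ?imset_f // -[v]sK -rE.
by exists x, y.
Qed.

(** An edge that lies in no triangle is itself a maximal clique. *)
Lemma clique_colorable_neq (T : finType) (r : rel T) (c : T -> bool) u v :
  symmetric r -> irreflexive r ->
  (forall K, mclique r K -> exists u v, [/\ u \in K, v \in K & c u != c v]) ->
  r u v -> (forall w, r u w -> r v w -> False) -> c u != c v.
Proof.
move=> rsym irr cP ruv triv.
have [|x [y [/set2P[->|->] /set2P[->|->]]]] := cP [set u; v].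
- split=> [x y /set2P[->|->] /set2P[->|->]|w]; rewrite ?eqxx //.
    by rewrite rsym.
  have [rwu|nwu] := boolP (r w u); last by exists u; rewrite ?set21.
  exists v; rewrite ?set22 //; apply/negP => rwv.
  by apply: (triv w); rewrite rsym.
- by rewrite eqxx.
- by [].
- by rewrite eq_sym.
- by rewrite eqxx.
Qed.

(** * The graph of a formula *)

Section Formulas.
Variables (sigma : vocab) (ex al : relsig) (W : finType).

(* [Nor i f g] stands for ~ exists i, f \/ g. *)
Inductive fml : Type :=
| FNum of numeric W
| FIn of literal sigma W
| FEx (R : rsym ex) of (arity R).-tuple W
| FAll (R : rsym al) of (arity R).-tuple W
| Nor of W & fml & fml.

Definition upd n (e : {ffun W -> 'I_n}) (i : W) (x : 'I_n) :
    {ffun W -> 'I_n} :=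
  [ffun j => if j == i then x else e j].

Variables (A : STRUC sigma).
Local Notation n := (usize A).

Fixpoint fsat (X : relint ex n) (Y : relint al n) (f : fml)
    (e : {ffun W -> 'I_n}) : bool :=
  match f with
  | FNum a => nsat (usize_gt1 A) a e
  | FIn l => lsat (A := A) l e
  | FEx R ts => X R (map_tuple e ts)
  | FAll R ts => Y R (map_tuple e ts)
  | Nor i f g =>
      ~~ [exists x, fsat X Y f (upd e i x) || fsat X Y g (upd e i x)]
  end.

End Formulas.

Arguments FNum {sigma ex al W}.
Arguments FIn {sigma ex al W}.
Arguments FEx {sigma ex al W}.
Arguments FAll {sigma ex al W}.

(** Vertices need a finite type of nodes: [P] is the type of occurrences of subformulas. The values
    of [chd] matter only at [Nor] nodes. *)
Lemma fml_nodes sigma ex al W (f : fml sigma ex al W) :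
  exists (P : finType) (fm : P -> fml sigma ex al W) (chd : bool -> P -> P) p,
    fm p = f /\ forall p i g h, fm p = Nor i g h ->
      fm (chd true p) = g /\ fm (chd false p) = h.
Proof.
elim: f => [a|l|R ts|R ts|i g [P [fm [chd [p [<- chdP]]]]]
  h [P' [fm' [chd' [p' [<- chdP']]]]]];
  try by [eexists unit, (fun=> _), (fun _ => id), tt; split].
exists (option (P + P')%type),
  (fun q => match q with None => Nor i (fm p) (fm' p')
            | Some (inl q) => fm q | Some (inr q) => fm' q end),
  (fun b q => match q with None => Some (if b then inl p else inr p')
              | Some (inl q) => Some (inl (chd b q))
              | Some (inr q) => Some (inr (chd' b q)) end),
  None; split=> // -[[q|q]|] j g0 h0; [exact: chdP|exact: chdP'|].
by case=> _ <- <-.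
Qed.

Section Graph.
Variables (sigma : vocab) (ex al : relsig) (W : finType).
Variables (P : finType) (fm : P -> fml sigma ex al W) (chd : bool -> P -> P).
Variables (p0 : P) (xv : forall R : rsym ex, (arity R).-tuple W).

(* The group [None] has only red members. In the group of the node [Some p]
   and an environment, the option [None] is blue, and [Some (b, side)] claims
   the truth value [b] for the node, [side] and the witness coordinate
   designating, if [b] is false, a true child. *)
Definition choice_tag : finType :=
  (option P * option (bool * bool))%type.

(* [inl (o, false)] are the vertices choosing the option [o], [inl (o, true)]
   transmit their colours, and [inr] are the vertices giving the colours of
   the atoms of the existential relations, [inr (None, true)] being red. *)
Definition vtag : finType :=
  (choice_tag * bool + option (rsym ex) * bool)%type.

Variables (A : STRUC sigma).
Local Notation n := (usize A).
Local Notation env := {ffun W -> 'I_n}.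
(** A key names a ground atom of [ex], or with [None] an atom that is always true. Bare lists of
    arguments give the keys of all arities one type with decidable equality. *)
Local Notation akey := (option (rsym ex) * seq 'I_n)%type.

(** All vertices have the same fields; a field that a tag ignores only creates non-adjacent
    copies. *)
Definition vertex : finType := (vtag * env * 'I_n)%type.

(** Atoms of [al] are compared across all nodes and environments, so that a clique fixes one
    interpretation of them. The other atoms are controlled by the colours instead. *)
Definition refutes (p : P) (b side : bool) (e : env) (w : 'I_n)
    (p' : P) (b' : bool) (e' : env) : bool :=
  match fm p with
  | Nor i _ _ =>
    if b then b' && ((p' == chd true p) || (p' == chd false p)) &&
              [forall j, (j != i) ==> (e' j == e j)]
    else ~~ b' && (p' == chd side p) && (e' == upd e i w)
  | FAll R ts =>
    if fm p' is FAll R' ts'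
    then (b != b') && (R == R') && (map e ts == map e' ts') else false
  | _ => false
  end.

Definition conflict (o : choice_tag) (e : env) (w : 'I_n)
    (o' : choice_tag) (e' : env) : bool :=
  if (o, o') is ((Some p, Some (b, side)), (Some p', Some (b', _)))
  then refutes p b side e w p' b' e' else false.

(* The constraint on [p0] says that the root node has to be false. *)
Definition colour (o : choice_tag) (e : env) : akey * bool :=
  match o with
  | (None, _) => ((None, [::]), true)
  | (Some p, None) => ((None, [::]), false)
  | (Some p, Some (b, _)) =>
    match fm p with
    | FNum a => ((None, [::]), nsat (usize_gt1 A) a e == b)
    | FIn l => ((None, [::]), lsat (A := A) l e == b)
    | FEx R ts => ((Some R, map e ts), b)
    | FAll _ _ => ((None, [::]), true)
    | Nor _ _ _ => ((None, [::]), (p == p0) ==> ~~ b)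
    end
  end.

Definition atom_key (a : option (rsym ex)) (e : env) : akey :=
  (a, if a is Some R then map e (xv R) else [::]).

(** A choice is joined to its transmitter, and the transmitter to the atom vertices prescribed by
    [colour]. Two changes of colour along this path give the choice the colour of its atom vertex;
    the two signs of an atom are adjacent, hence of opposite colours. *)
Definition adj (u v : vertex) : bool :=
  let: (t, e, w) := u in let: (t', e', w') := v in
  match t, t' with
  | inl (o, false), inl (o', false) =>
      ~~ ((o.1 == o'.1) && (e == e')) &&
      ~~ conflict o e w o' e' && ~~ conflict o' e' w' o e
  | inl (o, true), inl (o', true) => false
  | inl (o, _), inl (o', _) => (o == o') && (e == e')
  | inl (o, true), inr (a, s) => colour o e == (atom_key a e', s)
  | inr (a, s), inl (o, true) => colour o e' == (atom_key a e, s)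
  | inl (o, false), inr _ | inr _, inl (o, false) => false
  | inr (a, s), inr (a', s') => (atom_key a e == atom_key a' e') && (s != s')
  end.

Arguments colour : simpl never.
Arguments atom_key : simpl never.
Arguments conflict : simpl never.

Lemma adj_sym : symmetric adj.
Proof.
move=> [[[[o []]|[a s]] e] w] [[[[o' []]|[a' s']] e'] w'] //=.
- by rewrite eq_sym [e == _]eq_sym.
- by rewrite eq_sym [e == _]eq_sym.
- by rewrite eq_sym [e == _]eq_sym -!andbA; congr andb; rewrite andbC.
- by rewrite eq_sym [s == _]eq_sym.
Qed.

Lemma adj_irr : irreflexive adj.
Proof. by move=> [[[[o []]|[a s]] e] w] /=; rewrite ?eqxx ?andbF. Qed.

Definition chooses (u : vertex) : bool :=
  if u.1.1 is inl (_, false) then true else false.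

(** The neighbours of a vertex that is not a choice are pairwise non-adjacent. An edge at such a
    vertex therefore forces different colours, by [clique_colorable_neq]. *)
Lemma adj_triangle u v w :
  adj u v -> adj u w -> adj v w -> chooses u && chooses v.
Proof.
move: u v w => [[[[o []]|[a s]] e] x] [[[[o' []]|[a' s']] e'] x']
  [[[[o2 []]|[a2 s2]] e2] x2] //=.
- by move=> /andP[/eqP <- /eqP <-] /andP[/eqP <- /eqP <-]; rewrite !eqxx.
- move=> /eqP-> /eqP[_ _ ->]; by rewrite eqxx andbF.
- move=> /andP[/eqP <- /eqP <-] + /andP[/eqP oE /eqP eE].
  by rewrite -oE -eE !eqxx.
- by move=> /eqP-> + /eqP[_ _ E]; rewrite E eqxx andbF.
- by move=> /andP[_ ss'] /eqP-> /eqP[_ _ E]; rewrite E eqxx in ss'.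
- by case: s s' s2 => [] [] []; rewrite ?andbF.
Qed.

Definition key_val (X : relint ex n) (k : akey) : bool :=
  if k.1 is Some R
  then X R [tuple nth (zeroU A) k.2 i | i < arity R] else true.

Lemma key_val_tuple X R (e : env) (ts : (arity R).-tuple W) :
  key_val X (Some R, map e ts) = X R (map_tuple e ts).
Proof.
congr (X R _); apply: eq_from_tnth => i.
by rewrite tnth_mktuple (tnth_nth (zeroU A)).
Qed.

Definition is_red X (o : choice_tag) (e : env) : bool :=
  key_val X (colour o e).1 == (colour o e).2.

Definition paint X (u : vertex) : bool :=
  let: (t, e, _) := u in
  match t with
  | inl (o, b) => b (+) is_red X o e
  | inr (a, s) => key_val X (atom_key a e) == s
  end.

Lemma paint_adj X u v :
  adj u v -> ~~ (chooses u && chooses v) -> paint X u != paint X v.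
Proof.
move: u v => [[[[o []]|[a s]] e] w] [[[[o' []]|[a' s']] e'] w'] //=.
- by move=> /andP[/eqP <- /eqP <-] _; case: (is_red X o e).
- move=> /eqP oE _; rewrite /is_red oE /=.
  by case: (_ == s').
- by move=> /andP[/eqP <- /eqP <-] _; case: (is_red X o e).
- move=> /eqP oE _; rewrite /is_red oE /=.
  by case: (_ == s).
- by move=> /andP[/eqP ->] + _; case: key_val s s' => [] [] [].
Qed.

Lemma adj_ex u : exists v, adj u v.
Proof.
move: u => [[[[o b]|[a s]] e] w].
  by exists (inl (o, ~~ b), e, w); case: b; rewrite /= !eqxx.
by exists (inr (a, ~~ s), e, w); rewrite /= eqxx; case: s.
Qed.

(** * From an interpretation of the existential relations to a colouring *)

Hypothesis chdP : forall p i f g, fm p = Nor i f g ->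
  fm (chd true p) = f /\ fm (chd false p) = g.
Hypothesis p0P : exists i f g, fm p0 = Nor i f g.

(** A formula is never an immediate subformula of itself. Hence a claim on a node and a claim on its
    child are distinct vertices, which the clique condition requires before it makes them
    adjacent. *)
Lemma chd_neq p i f g b : fm p = Nor i f g -> chd b p != p.
Proof.
have neql (h k : fml sigma ex al W) j : h <> Nor j h k.
  by elim: h k j => // j0 h IHh k _ k' j [_ /esym + _]; exact/nesym/IHh.
have neqr (h k : fml sigma ex al W) j : k <> Nor j h k.
  by elim: k h j => // j0 h _ k IHk k' j [_ _ /esym]; exact/nesym/IHk.
move=> pE; have [pf pg] := chdP pE; apply/eqP; case: b => chE.
  by move: pf; rewrite chE pE => /esym/neql.
by move: pg; rewrite chE pE => /esym/neqr.
Qed.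

Definition pick_vertex q o e w : vertex := (inl ((q, o), false), e, w).

Lemma chd_pick p i f g b o e w o' e' w' : fm p = Nor i f g ->
  pick_vertex (Some p) o e w != pick_vertex (Some (chd b p)) o' e' w'.
Proof.
by move=> /chd_neq-/(_ b); apply: contra => /eqP[] /esym->.
Qed.

Lemma choosesP u : chooses u -> exists q o e w, u = pick_vertex q o e w.
Proof. by move: u => [[[[[q o] []]|[a s]] e] w] // _; exists q, o, e, w. Qed.

Lemma conflict_blue_l q e w o e' : conflict (q, None) e w o e' = false.
Proof. by case: q. Qed.

Lemma conflict_blue_r q e w o e' : conflict o e w (q, None) e' = false.
Proof. by case: o q => [[p|] [[b sd]|]] [p'|]. Qed.

(** Serves to read an interpretation of [al] off a clique. *)
Definition claims (R : rsym al) (t : (arity R).-tuple 'I_n) (u : vertex) :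
    bool :=
  if u is (inl ((Some p, Some (true, _)), _), e, _) then
    if fm p is FAll R' ts then (R' == R) && (map e ts == t) else false
  else false.

(** A monochromatic maximal clique for [paint X] would evaluate the formula for some [Y], and its
    red claims on the root would make the root false in every environment. *)
Lemma models_clique_colorable X :
  (forall Y, exists e, fsat (A := A) X Y (fm p0) e) -> clique_colorable adj.
Proof.
move=> XP; exists (paint X) => K [cK maxK].
have [/exists_inP[u uK nu]|/exists_inPn allc] :=
    boolP [exists u in K, ~~ chooses u].
  (* A member of [K] that is not adjacent to a neighbour of [u] differs from [u], and the edge
     between them is bichromatic. *)
  have [v uv] := adj_ex u; have [x xK nvx] := maxK v; exists u, x; split=> //.
  have ux : u != x by apply: contraNneq nvx => <-; rewrite adj_sym.
  by apply: paint_adj; [exact: cK|rewrite (negPf nu)].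
apply: contrapT => nex.
have mono u v : u \in K -> v \in K -> paint X u = paint X v.
  by move=> uK vK; apply: contrapT => /eqP uv; apply: nex; exists u, v.
(* The blue choice of a group conflicts with nothing, so its non-neighbour in [K] lies in the same
   group: [K] meets every group. *)
have groupK q e : exists o w, pick_vertex q o e w \in K.
  have [u uK] := maxK (pick_vertex q None e (zeroU A)).
  have /negPn/choosesP[q' [o' [e' [w' uE]]]] := allc u uK; rewrite {u}uE in uK *.
  rewrite /= conflict_blue_l conflict_blue_r.
  by rewrite !andbT negbK => /andP[/eqP -> /eqP ->]; exists o', w'.
(* The member of the entirely red group [None] fixes the common colour. *)
have red u : u \in K -> paint X u.
  have [o [w oK]] := groupK None [ffun=> zeroU A] => uK.
  by rewrite (mono _ _ uK oK).
have nodeK p e : exists b sd w, pick_vertex (Some p) (Some (b, sd)) e w \in K.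
  have [[[b sd]|] [w oK]] := groupK (Some p) e; first by exists b, sd, w.
  by have := red _ oK.
pose Y : relint al n := fun R t => [exists u in K, claims t u].
have noconf q o e w q' o' e' w' : pick_vertex q o e w \in K ->
    pick_vertex q' o' e' w' \in K ->
    pick_vertex q o e w != pick_vertex q' o' e' w' ->
    conflict (q, o) e w (q', o') e' = false.
  by move=> uK vK uv; have /andP[/andP[_ /negPf]] := cK _ _ uK vK uv.
(* The induction is on formulas, for all nodes carrying them, since [P] has no inductive structure
   of its own. *)
have sound f : forall p b sd e w, fm p = f ->
    pick_vertex (Some p) (Some (b, sd)) e w \in K -> fsat (A := A) X Y f e = b.
  elim: f => [a|l|R ts|R ts|i f IHf g IHg] p b sd e w pE pK.
  - by have := red _ pK; rewrite /= /is_red /colour pE /= => /eqP/esym/eqP.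
  - by have := red _ pK; rewrite /= /is_red /colour pE /= => /eqP/esym/eqP.
  - have := red _ pK; rewrite /= /is_red /colour pE key_val_tuple.
    by move/eqP.
  - case: b pK => pK.
      by apply/exists_inP; eexists; [exact: pK|rewrite /= pE !eqxx].
    apply/negbTE/negP => /exists_inP[[[[[[q' o'] d]|//] e'] w']].
    case: q' o' => [p'|//] [[[] sd']|//] uK //=.
    case pE': (fm p') => [||||] //= /andP[/eqP RE /eqP eE].
    (* [claims] also accepts transmitters, but [K] consists of choices. *)
    have d0 : d = false by have /negPn := allc _ uK; case: d {uK}.
    rewrite d0 in uK; have := noconf _ _ _ _ _ _ _ _ pK uK.
    rewrite /conflict /refutes pE pE' eE RE !eqxx => uv.
    by have /uv : pick_vertex (Some p) (Some (false, sd)) e w !=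
      pick_vertex (Some p') (Some (true, sd')) e' w' by apply/eqP => -[].
  - have [pf pg] := chdP pE.
    have IH sd' b' e' w' q : pick_vertex (Some (chd sd' p)) (Some (b', q)) e' w'
        \in K -> fsat (A := A) X Y (if sd' then f else g) e' = b'.
      by case: sd'; [apply: IHf|apply: IHg].
    case: b pK => pK.
      apply/existsPn => x.
      have chK sd' : fsat (A := A) X Y (if sd' then f else g) (upd e i x) = false.
        have [b' [sd2 [w' cK']]] := nodeK (chd sd' p) (upd e i x).
        rewrite (IH _ _ _ _ _ cK').
        have := noconf _ _ _ _ _ _ _ _ pK cK' (chd_pick _ _ _ _ _ _ _ pE).
        rewrite /conflict /refutes pE => /negbT.
        have -> : [forall j, (j != i) ==> (upd e i x j == e j)].
          by apply/forallP => j; apply/implyP => /negPf ji; rewrite ffunE ji.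
        have -> : (chd sd' p == chd true p) || (chd sd' p == chd false p).
          by case: sd' {cK'}; rewrite eqxx ?orbT.
        by rewrite !andbT => /negPf.
      by rewrite negb_or; apply/andP; split; apply/negbT; [exact: (chK true)|exact: (chK false)].
    (* A claim that the node is false designates a child and a witness; the choice of [K] for that
       child can only be true. *)
    have [b' [sd2 [w' cK']]] := nodeK (chd sd p) (upd e i w).
    have b'1 : b' = true.
      have := noconf _ _ _ _ _ _ _ _ pK cK' (chd_pick _ _ _ _ _ _ _ pE).
      by rewrite /conflict /refutes pE !eqxx !andbT => /negbFE.
    apply/negbF/existsP; exists w; have := IH _ _ _ _ _ cK'.
    by rewrite b'1; case: (sd) => ?; apply/orP; [left|right].
(* By soundness the claim on the root in [e] is true, and such a claim is not red. *)
have [e eP] := XP Y; have [b [sd [w p0K]]] := nodeK p0 e.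
have := sound _ _ _ _ _ _ erefl p0K; rewrite eP => b1.
have := red _ p0K; have [i [f [g p0E]]] := p0P.
by rewrite /= /is_red /colour p0E eqxx -b1.
Qed.

(** * From a colouring to an interpretation of the existential relations *)

Hypothesis xv_uniq : forall R, uniq (xv R).

Lemma xv_onto R (t : seq 'I_n) : size t = arity R ->
  exists e : env, map e (xv R) = t.
Proof.
move=> st; exists [ffun j => nth (zeroU A) t (index j (xv R))].
apply: (@eq_from_nth _ (zeroU A)) => [|k]; first by rewrite size_map size_tuple.
rewrite size_map => kR.
(* Any variable will do as the default that [nth_map] asks for. *)
have [j _] : exists j : W, True by case: (tval (xv R)) kR => // j; exists j.
by rewrite (nth_map j) // ffunE index_uniq.
Qed.

(** Every choice thus has an atom vertex at the end of its transmitting path. *)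
Lemma colour_key o e : exists a e', (colour o e).1 = atom_key a e'.
Proof.
have no : exists a e', (None, [::]) = atom_key a e' by exists None, e.
move: o => [[p|] // [[b sd]|] //]; rewrite /colour; case: (fm p) => //= R ts.
have [|e' eE] := @xv_onto R (map e ts); first by rewrite size_map size_tuple.
by exists (Some R), e'; rewrite /atom_key eE.
Qed.

Definition truthful (X : relint ex n) (Y : relint al n)
    (qe : option P * env) (v : vertex) : Prop :=
  exists o w, v = pick_vertex qe.1 o qe.2 w /\
  if qe.1 is Some p then
    exists b sd, [/\ o = Some (b, sd), fsat X Y (fm p) qe.2 = b &
      forall i f g, fm p = Nor i f g -> b = false ->
        fsat X Y (fm (chd sd p)) (upd qe.2 i w)]
  else True.

Lemma truthful_ex X Y qe : exists v, truthful X Y qe v.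
Proof.
case: qe => [[p|] e]; last by exists (pick_vertex None None e (zeroU A)), None,
  (zeroU A).
have [b bE] : exists b, fsat X Y (fm p) e = b by eexists.
suff [sd [w H]] : exists sd w, forall i f g, fm p = Nor i f g -> b = false ->
    fsat X Y (fm (chd sd p)) (upd e i w).
  by exists (pick_vertex (Some p) (Some (b, sd)) e w), (Some (b, sd)), w;
    split=> //; exists b, sd.
case pE: (fm p) bE => [a|l|R ts|R ts|i f g] bE;
  try by exists true, (zeroU A).
have [pf pg] := chdP pE; case: b bE => [_|/negbFE/existsP[w]].
  by exists true, (zeroU A).
by case/orP => H; [exists true, w|exists false, w] => _ _ _ [<- _ _] _;
  rewrite ?pf ?pg.
Qed.

(** Claims that are all true for the same [X] and [Y] cannot contradict each other. *)
Lemma truthful_conflict X Y q e o w q' e' o' w' :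
  truthful X Y (q, e) (pick_vertex q o e w) ->
  truthful X Y (q', e') (pick_vertex q' o' e' w') ->
  conflict (q, o) e w (q', o') e' = false.
Proof.
move=> [o1 [w1 [[<- <-] /= H]]] [o2 [w2 [[<- <-] /= H']]].
move: H H'; rewrite /conflict; case: q q' => [p|] // [p'|] //; last first.
  by case: o => [[]|].
move=> [b [sd [-> bE wP]]] [b' [sd' [-> b'E _]]]; rewrite /refutes.
case pE: (fm p) => [a|l|R ts|R ts|i f g] //.
  case p'E: (fm p') => [a|l|R' ts'|R' ts'|i f g] //.
  apply/negbTE/negP => /andP[/andP[+ /eqP RE]]; move: ts' p'E; rewrite -RE.
  move=> ts' p'E + /eqP tE.
  rewrite -bE -b'E pE p'E /= (_ : map_tuple e ts = map_tuple e' ts') ?eqxx //.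
  exact/val_inj.
have [pf pg] := chdP pE.
case: b bE wP => bE wP; apply/negbTE/negP.
  move=> /andP[/andP[b'1 p'E] /forallP eE].
  (* The environment of the true child is itself a witness against the true [Nor]. *)
  have e'E : e' = upd e i (e' i).
    apply/ffunP => j; rewrite ffunE; case: eqP => [->//|/eqP ji].
    by have := eE j; rewrite ji => /eqP.
  move: bE; rewrite pE /= => /existsP[]; exists (e' i); rewrite -e'E.
  move: b'E; rewrite b'1; case/orP: p'E => /eqP ->; rewrite ?pf ?pg => ->//.
  by rewrite orbT.
move=> /andP[/andP[b'0 /eqP p'E] /eqP eE]; have := wP _ _ _ pE erefl.
by rewrite -p'E -eE b'E (negPf b'0).
Qed.

(** [X] is read off the colours of the atom vertices. If some [Y] made the root false everywhere,
    one truthful choice per group would give a monochromatic maximal clique. *)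
Lemma clique_colorable_models : clique_colorable adj ->
  exists X, forall Y, exists e, fsat (A := A) X Y (fm p0) e.
Proof.
move=> [c cP].
have neq u v : adj u v -> ~~ (chooses u && chooses v) -> c u != c v.
  move=> uv nch; apply: (clique_colorable_neq adj_sym adj_irr cP) => // w uw vw.
  by have := adj_triangle uv uw vw; apply/negP.
pose z := zeroU A; pose e0 : env := [ffun=> z].
pose atomv a s e w : vertex := (inr (a, s), e, w).
have atomN a s e e' w w' : atom_key a e = atom_key a e' ->
    c (atomv a s e w) = ~~ c (atomv a (~~ s) e' w').
  move=> eE; have := neq (atomv a s e w) (atomv a (~~ s) e' w').
  rewrite /= eE eqxx /= (_ : s != ~~ s); last by case: s.
  by move=> /(_ erefl erefl); do 2!case: (c _).
(* Copies of an atom vertex share a neighbour of the opposite sign. *)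
have atomE a s e e' w w' : atom_key a e = atom_key a e' ->
    c (atomv a s e w) = c (atomv a s e' w').
  by move=> eE; rewrite (atomN _ _ _ _ _ z eE) [RHS](atomN _ _ _ e' _ z).
(* [T] is the colour that stands for red; the colouring may have exchanged the two. *)
pose T := c (atomv None true e0 z).
have [ext extE] : exists ext : forall R, (arity R).-tuple 'I_n -> env,
    forall R t, map (ext R t) (xv R) = t.
  have H R (t : (arity R).-tuple 'I_n) : exists e : env, map e (xv R) = t.
    by apply: xv_onto; rewrite size_tuple.
  by exists (fun R t => sval (cid (H R t))) => R t; exact: (svalP (cid (H R t))).
pose X : relint ex n := fun R t => c (atomv (Some R) true (ext R t) z) == T.
have atomX a s e w : (c (atomv a s e w) == T) = (key_val X (atom_key a e) == s).
  wlog -> : s / s = true => [H|].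
    case: s; first exact: H.
    rewrite (atomN _ _ _ e _ w) //; have := H true erefl.
    by case: (c _); case: (T); case: (key_val _ _).
  rewrite eqb_id; case: a => [R|].
    by rewrite key_val_tuple /X (@atomE _ _ e (ext R (map_tuple e (xv R))) w z) //
      /atom_key extE.
  by rewrite /T (@atomE _ _ e e0 w z) // eqxx.
(* Two forced changes of colour, through the transmitter. *)
have chooseX q o e w : (c (pick_vertex q o e w) == T) = is_red X (q, o) e.
  have [a [e' aE]] := colour_key (q, o) e; set s := (colour (q, o) e).2.
  have := neq (pick_vertex q o e w) (inl ((q, o), true), e, w).
  have := neq (inl ((q, o), true), e, w) (atomv a s e' w); rewrite {2}/atomv.
  rewrite /is_red aE -(atomX a s e' w) /= -aE /s -surjective_pairing !eqxx.
  by move=> /(_ erefl erefl) + /(_ erefl erefl); do 3!case: (c _); case: (T).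
exists X => Y; apply: contrapT => nex.
have root0 e : fsat X Y (fm p0) e = false.
  by apply/negbTE/negP => p0e; apply: nex; exists e.
have [pk pkP] := choice (truthful_ex X Y).
have pkE q e : exists o w, pk (q, e) = pick_vertex q o e w /\
    truthful X Y (q, e) (pick_vertex q o e w).
  have [o [w [E _]]] := pkP (q, e); exists o, w.
  by split=> //; move: (pkP (q, e)); rewrite E.
have [|u [v [/imsetP[[q e] _ ->] /imsetP[[q' e'] _ ->]]]] := cP [set pk qe | qe : option P * env].
  split=> [_ _ /imsetP[[q e] _ ->] /imsetP[[q' e'] _ ->]|].
    have [[-> ->]|qe] := eqVneq (q, e) (q', e'); first by rewrite eqxx.
    have [o [w [-> tu]]] := pkE q e; have [o' [w' [-> tv]]] := pkE q' e'.
    rewrite /= (truthful_conflict tu tv) (truthful_conflict tv tu) !andbT.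
    by move=> _; rewrite -xpair_eqE.
  move=> v; have [chv|nchv] := boolP (chooses v).
    have [q [o [e [w ->]]]] := choosesP chv; exists (pk (q, e)).
      by rewrite imset_f.
    by have [o' [w' [-> _]]] := pkE q e; rewrite /= !eqxx.
  (* A vertex that is not a choice has neighbours in at most one group, so it misses the member of
     group [None] or that of a root group. *)
  have nadj q q' e e' : q != q' ->
      adj v (pk (q, e)) -> adj v (pk (q', e')) -> False.
    have [o [w [-> _]]] := pkE q e; have [o' [w' [-> _]]] := pkE q' e'.
    move: v nchv => [[[[o2 []]|[a s]] e2] w2] //= _ qq'.
    by move=> /andP[/eqP -> _] /andP[/eqP[qE _]]; rewrite qE eqxx in qq'.
  have [vN|vN] := boolP (adj v (pk (None, e0))); last first.
    by exists (pk (None, e0)); rewrite ?imset_f.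
  exists (pk (Some p0, e0)); rewrite ?imset_f //.
  by apply/negP => /(nadj None (Some p0) _ _ isT vN).
have red q1 e1 : c (pk (q1, e1)) = T.
  have [o [w [-> tu]]] := pkE q1 e1; apply/eqP; rewrite chooseX.
  case: q1 o tu => [p|] o.
    move=> [o1 [w1 [[<- <-] /= [b [sd [-> bE _]]]]]].
    rewrite /is_red /colour; case pE: (fm p) bE => [a|l|R ts|R ts|i f g] bE //=.
    - by rewrite -bE /= eqxx.
    - by rewrite -bE /= eqxx.
    - by rewrite key_val_tuple -bE.
    (* The truthful claim on the root is red because [Y] falsifies the root. *)
    - by case: (p =P p0) => // pp0; rewrite -bE -pE pp0 root0.
  by [].
by rewrite !red eqxx.
Qed.

Lemma clique_colorable_modelsE : clique_colorable adj <->
  exists X, forall Y, exists e, fsat (A := A) X Y (fm p0) e.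
Proof.
split=> [|[X]]; first exact: clique_colorable_models.
exact: models_clique_colorable.
Qed.

End Graph.

(** * Definability of the graph by a projection *)

Fixpoint fo_map sigma (V V' : Type) (h : V -> V') (f : fo sigma V) :
    fo sigma V' :=
  let tm (T T' : Type) (g : T -> T') (t : term sigma T) : term sigma T' :=
    match t with
    | Var v => Var sigma (g v)
    | Cst c => Cst T' c
    | Zero => Zero sigma T'
    | One => One sigma T'
    | Max => Max sigma T'
    end in
  match f with
  | Eq s t => Eq (tm _ _ h s) (tm _ _ h t)
  | Le s t => Le (tm _ _ h s) (tm _ _ h t)
  | Bit s t => Bit (tm _ _ h s) (tm _ _ h t)
  | Plus s t u => Plus (tm _ _ h s) (tm _ _ h t) (tm _ _ h u)
  | Times s t u => Times (tm _ _ h s) (tm _ _ h t) (tm _ _ h u)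
  | Suc s t => Suc (tm _ _ h s) (tm _ _ h t)
  | Rel R ts => Rel (map_tuple (tm _ _ h) ts)
  | Not f => Not (fo_map h f)
  | And f g => And (fo_map h f) (fo_map h g)
  | Or f g => Or (fo_map h f) (fo_map h g)
  | Ex f => Ex (fo_map (omap h) f)
  | All f => All (fo_map (omap h) f)
  end.

Lemma sat_fo_map sigma (A : STRUC sigma) (V V' : Type) (h : V -> V')
    (f : fo sigma V) (e : V' -> 'I_(usize A)) :
  sat (A := A) (fo_map h f) e = sat f (e \o h).
Proof.
elim: f V' h e => {V} [V s t|V s t|V s t|V s t u|V s t u|V s t|V R ts|V f IH|
    V f IHf g IHg|V f IHf g IHg|V f IH|V f IH] V' h e /=;
  rewrite ?IH ?IHf ?IHg //; try by repeat match goal with t : term _ _ |- _ =>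
    case: t => [?|?|||] end.
- congr relv; apply: eq_from_tnth => i; rewrite !tnth_map.
  by case: (tnth ts i).
- by apply: eq_existsb => x; rewrite IH; congr sat; apply: funext; case.
- by apply: eq_forallb => x; rewrite IH; congr sat; apply: funext; case.
Qed.

Section Numeric.
Variables (V : Type).

(** Conditions on tags and nodes do not depend on the structure; they are decided beforehand and
    enter the formulas as constants. *)
Definition nconst (b : bool) : numeric V :=
  let t := Eq (Zero vocab0 V) (Zero vocab0 V) in if b then t else Not t.

Definition nall : seq (numeric V) -> numeric V :=
  foldr (@And vocab0 V) (nconst true).

Definition nany : seq (numeric V) -> numeric V :=
  foldr (@Or vocab0 V) (nconst false).

Definition neqs (s : seq (V * V)) : numeric V :=
  nall [seq Eq (Var vocab0 p.1) (Var vocab0 p.2) | p <- s].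

Variables (n : nat) (n_gt1 : 1 < n) (e : V -> 'I_n).

Lemma nsat_const b : nsat n_gt1 (nconst b) e = b.
Proof. by case: b. Qed.

Lemma nsat_all s : nsat n_gt1 (nall s) e = all (fun a => nsat n_gt1 a e) s.
Proof. by elim: s => //= a s <-. Qed.

Lemma nsat_any s : nsat n_gt1 (nany s) e = has (fun a => nsat n_gt1 a e) s.
Proof. by elim: s => //= a s <-. Qed.

Lemma nsat_eqs s : nsat n_gt1 (neqs s) e = all (fun p => e p.1 == e p.2) s.
Proof. by rewrite nsat_all all_map. Qed.

Lemma nsat_zip s s' : size s = size s' ->
  nsat n_gt1 (neqs (zip s s')) e = (map e s == map e s').
Proof.
rewrite nsat_eqs; elim: s s' => [|x s IH] [|y s'] //= [ss'].
by rewrite eqseq_cons IH.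
Qed.

Lemma nsat_and a b :
  nsat n_gt1 (And a b) e = nsat n_gt1 a e && nsat n_gt1 b e.
Proof. by []. Qed.

Lemma nsat_not a : nsat n_gt1 (Not a) e = ~~ nsat n_gt1 a e.
Proof. by []. Qed.

End Numeric.

Definition larg_map sigma (V V' : Type) (h : V -> V') (a : larg sigma V) :
    larg sigma V' :=
  match a with inl v => inl (h v) | inr c => inr c end.

(** The comparison with [b] is absorbed in the sign, so that a single literal remains, as a
    projection demands. *)
Definition signed_literal sigma (V V' : Type) (h : V -> V') (b : bool)
    (l : literal sigma V) : literal sigma V' :=
  Literal (lsign l == b)
    match lat l with
    | LEq x y => LEq (larg_map h x) (larg_map h y)
    | LRel R ts => LRel (map_tuple (larg_map h) ts)
    end.

Lemma lsat_signed sigma (A : STRUC sigma) (V V' : Type) (h : V -> V') b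
    (l : literal sigma V) (e : V' -> 'I_(usize A)) :
  lsat (A := A) (signed_literal h b l) e = (lsat (A := A) l (e \o h) == b).
Proof.
have largE a : largval e (larg_map h a) = largval (e \o h) a by case: a.
case: l => s [x y|R ts]; rewrite /lsat /= ?largE.
  by case: (largval _ x == _) s b => [] [] [].
rewrite (_ : [tuple of _] = [tuple of map (largval (e \o h)) ts]).
  by case: relv; case: s b => [] [].
by apply: eq_from_tnth => i; rewrite !tnth_map.
Qed.

Section Definability.
Variables (sigma : vocab) (ex al : relsig) (W : finType).
Variables (P : finType) (fm : P -> fml sigma ex al W) (chd : bool -> P -> P).
Variables (p0 : P) (xv : forall R : rsym ex, (arity R).-tuple W).
Local Notation vtag := (vtag ex P).
Local Notation choice_tag := (choice_tag P).

Section Formulas.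
Variable V : Type.
Local Notation form := (numeric V + literal sigma V)%type.

Definition nsame (ev ev' : W -> V) : numeric V :=
  neqs [seq (ev j, ev' j) | j <- enum W].

Definition nrefutes (p : P) (b side : bool) (ev : W -> V) (wv : V)
    (p' : P) (b' : bool) (ev' : W -> V) : numeric V :=
  match fm p with
  | Nor i _ _ =>
    if b then And (nconst V (b' && ((p' == chd true p) || (p' == chd false p))))
                  (neqs [seq (ev' j, ev j) | j <- enum W & j != i])
    else And (nconst V (~~ b' && (p' == chd side p)))
             (nsame ev' (fun j => if j == i then wv else ev j))
  | FAll R ts =>
    if fm p' is FAll R' ts'
    then And (nconst V ((b != b') && (R == R')))
             (neqs (zip (map ev ts) (map ev' ts')))
    else nconst V false
  | _ => nconst V false
  end.

Definition nconflict (o : choice_tag) (ev : W -> V) (wv : V)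
    (o' : choice_tag) (ev' : W -> V) : numeric V :=
  if (o, o') is ((Some p, Some (b, side)), (Some p', Some (b', _)))
  then nrefutes p b side ev wv p' b' ev' else nconst V false.

(** An [inr] arises only from a claim on an input literal: every other edge of the graph is
    numeric. *)
Definition ncolour (o : choice_tag) (ev : W -> V) (a : option (rsym ex))
    (s : bool) (ev' : W -> V) : form :=
  match o with
  | (None, _) => inl (nconst V (~~ isSome a && s))
  | (Some p, None) => inl (nconst V (~~ isSome a && ~~ s))
  | (Some p, Some (b, _)) =>
    match fm p, a with
    | FNum f, None =>
        inl (if b == s then fo_map ev f else Not (fo_map ev f))
    | FIn l, None => inr (signed_literal ev (b == s) l)
    | FEx R ts, Some R' =>
        inl (And (nconst V ((R == R') && (b == s)))
                 (neqs (zip (map ev ts) (map ev' (xv R')))))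
    | FAll _ _, None => inl (nconst V s)
    | Nor _ _ _, None => inl (nconst V (((p == p0) ==> ~~ b) == s))
    | _, _ => inl (nconst V false)
    end
  end.

Definition natom_key (a a' : option (rsym ex)) (ev ev' : W -> V) : numeric V :=
  match a, a' with
  | Some R, Some R' =>
      And (nconst V (R == R')) (neqs (zip (map ev (xv R)) (map ev' (xv R'))))
  | None, None => nconst V true
  | _, _ => nconst V false
  end.

Definition nadj (t : vtag) (ev : W -> V) (wv : V)
    (t' : vtag) (ev' : W -> V) (wv' : V) : form :=
  match t, t' with
  | inl (o, false), inl (o', false) =>
      inl (And (Not (And (nconst V (o.1 == o'.1)) (nsame ev ev')))
               (And (Not (nconflict o ev wv o' ev'))
                    (Not (nconflict o' ev' wv' o ev))))
  | inl (o, true), inl (o', true) => inl (nconst V false)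
  | inl (o, _), inl (o', _) => inl (And (nconst V (o == o')) (nsame ev ev'))
  | inl (o, true), inr (a, s) => ncolour o ev a s ev'
  | inr (a, s), inl (o, true) => ncolour o ev' a s ev
  | inl (o, false), inr _ | inr _, inl (o, false) => inl (nconst V false)
  | inr (a, s), inr (a', s') =>
      inl (And (natom_key a a' ev ev') (nconst V (s != s')))
  end.

End Formulas.

Section Semantics.
Variables (A : STRUC sigma) (V : Type) (x : V -> 'I_(usize A)).
Local Notation n := (usize A).
Local Notation holds f := (nsat (usize_gt1 A) f x).

Definition form_sat (f : numeric V + literal sigma V) : bool :=
  match f with inl a => holds a | inr l => lsat (A := A) l x end.

Definition env_of (ev : W -> V) : {ffun W -> 'I_n} := [ffun j => x (ev j)].

Lemma map_env_of (ev : W -> V) s : map x (map ev s) = map (env_of ev) s.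
Proof. by rewrite -map_comp; apply: eq_map => j; rewrite /= ffunE. Qed.

Lemma nsat_same ev ev' : holds (nsame ev ev') = (env_of ev == env_of ev').
Proof.
rewrite nsat_eqs all_map; apply/allP/eqP => [H|H j _].
  by apply/ffunP => j; rewrite !ffunE; apply/eqP/H; rewrite mem_enum.
by move/ffunP/(_ j): H; rewrite !ffunE /= => ->.
Qed.

Lemma nsat_refutes p b side ev wv p' b' ev' :
  holds (nrefutes p b side ev wv p' b' ev') =
  refutes fm chd p b side (env_of ev) (x wv) p' b' (env_of ev').
Proof.
rewrite /nrefutes /refutes; case: (fm p) => [a|l|R ts|R ts|i f g] //.
  case: (fm p') => [a|l|R' ts'|R' ts'|i f g] //.
  rewrite nsat_and nsat_const; case: (R =P R') => [RR'|]; last by rewrite !andbF.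
  by rewrite nsat_zip ?map_env_of // !size_map !size_tuple RR'.
case: b; rewrite nsat_and nsat_const; last first.
  rewrite nsat_same; congr (_ && (_ == _)); apply/ffunP => j.
  by rewrite !ffunE; case: eqP.
congr andb; rewrite nsat_eqs all_map; apply/allP/forallP => [H j|H j].
  by apply/implyP => ji; rewrite !ffunE; apply: H; rewrite mem_filter ji mem_enum.
by rewrite mem_filter => /andP[ji _]; have := H j; rewrite ji !ffunE.
Qed.

Lemma nsat_conflict o ev wv o' ev' :
  holds (nconflict o ev wv o' ev') =
  conflict fm chd o (env_of ev) (x wv) o' (env_of ev').
Proof.
by case: o o' => [[p|] [[b sd]|]] [[p'|] [[b' sd']|]] //; exact: nsat_refutes.
Qed.

Lemma nsat_colour o ev a s ev' :
  form_sat (ncolour o ev a s ev') =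
  (colour fm p0 o (env_of ev) == (atom_key xv a (env_of ev'), s)).
Proof.
have envE : x \o ev = env_of ev by apply: funext => j; rewrite ffunE.
case: o => [[p|] [[b sd]|]]; rewrite /ncolour /colour;
  try by case: a => [R|]; case: s.
case: (fm p) => [f|l|R ts|R ts|i f g]; case: a => [R'|];
  rewrite /form_sat ?nsat_const ?xpair_eqE //.
- case: (b =P s) => [->|/eqP bs]; rewrite /nsat /= sat_fo_map envE.
    by case: (sat _ _) s => [] [].
  by case: (sat _ _) b s bs => [] [] [].
- rewrite lsat_signed envE; by case: (lsat _ _) b s => [] [] [].
- rewrite nsat_and nsat_const.
  rewrite (_ : (Some R == Some R') = (R == R')) //.
  case: (R =P R') => [RR'|//] /=; rewrite nsat_zip ?map_env_of 1?andbC //.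
  by rewrite !size_map !size_tuple RR'.
Qed.

Lemma nsat_atom_key a a' ev ev' : holds (natom_key a a' ev ev') =
  (atom_key xv a (env_of ev) == atom_key xv a' (env_of ev')).
Proof.
case: a a' => [R|] [R'|] //; rewrite /atom_key xpair_eqE nsat_and nsat_const.
rewrite (_ : (Some R == Some R') = (R == R')) //.
case: (R =P R') => [RR'|//] /=; rewrite nsat_zip ?map_env_of //.
by rewrite !size_map !size_tuple RR'.
Qed.

Lemma nadjP t ev wv t' ev' wv' : form_sat (nadj t ev wv t' ev' wv') =
  adj fm chd p0 xv (t, env_of ev, x wv) (t', env_of ev', x wv').
Proof.
case: t t' => [[o []]|[a s]] [[o' []]|[a' s']]; rewrite /nadj ?nsat_colour //;
  rewrite /form_sat
    ?(nsat_and, nsat_not, nsat_same, nsat_conflict, nsat_const) //.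
- by rewrite /adj andbA.
- by rewrite nsat_atom_key.
Qed.

End Semantics.

(** * Coordinates of the vertices and the edge formula *)

Definition coord : finType := (vtag + W + unit)%type.

Definition cvar (a : 'I_2) (c : coord) : 'I_2 * 'I_#|coord| := (a, enum_rank c).
Definition tag_var a t := cvar a (inl (inl t)).
Definition env_var a j := cvar a (inl (inr j)).
Definition wit_var a := cvar a (inr tt).

(* Every tuple of coordinates denotes a vertex; the ones with the same fields
   are non-adjacent copies of each other. *)
Definition decode (g : vtag -> bool) : vtag :=
  odflt (inr (None, true)) [pick t | g t].

(** Tags have one coordinate each, read as zero or nonzero, since a universe of two elements is too
    small to number them. The disjunction runs over all zero patterns that [decode] sends to [t]. *)
Definition tag_form (a : 'I_2) (t : vtag) : numeric ('I_2 * 'I_#|coord|) :=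
  nany [seq nall [seq let z := Eq (Var _ (tag_var a t')) (Zero _ _) in
                      if g t' then Not z else z | t' <- enum vtag]
       | g : {ffun vtag -> bool} <- enum {ffun vtag -> bool} & decode g == t].

Lemma nsat_tag n (n_gt1 : 1 < n) (x : 'I_2 * 'I_#|coord| -> 'I_n) a t :
  nsat n_gt1 (tag_form a t) x =
  (decode (fun t' => x (tag_var a t') != 0 :> nat) == t).
Proof.
pose g0 := [ffun t' => x (tag_var a t') != 0 :> nat].
have gE (g : {ffun vtag -> bool}) : nsat n_gt1 (nall [seq
    let z := Eq (Var _ (tag_var a t')) (Zero _ _) in
    if g t' then Not z else z | t' <- enum vtag]) x = (g == g0).
  rewrite nsat_all all_map; apply/allP/eqP => [H|-> t' _]; last first.
    by rewrite /= ffunE; case: ifPn => //=; rewrite negbK.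
  apply/ffunP => t'; have := H t'; rewrite mem_enum => /(_ isT).
  by rewrite ffunE /=; case: (g t') => //= /eqP ->.
rewrite nsat_any has_map; transitivity (decode g0 == t); last first.
  by congr (odflt _ _ == _); apply: eq_pick => t'; rewrite ffunE.
apply/hasP/idP => [[g]|g0t].
  rewrite mem_filter => /andP[gt _] H.
  by have /eqP <- : g == g0 by rewrite -gE.
have := gE g0; rewrite eqxx => H; exists g0 => //.
by rewrite mem_filter g0t mem_enum.
Qed.

Local Notation V2 := ('I_2 * 'I_#|coord|)%type.

Definition pair_form (p : vtag * vtag) : numeric V2 + literal sigma V2 :=
  nadj p.1 (env_var ord0) (wit_var ord0) p.2 (env_var ord_max) (wit_var ord_max).

(* A harmless literal where the formula of a pair of tags is numeric. *)
Definition pair_literal p : literal sigma V2 :=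
  if pair_form p is inr l then l
  else Literal true (LEq (inl (wit_var ord0)) (inl (wit_var ord0))).

Definition is_numeric p := if pair_form p is inl _ then true else false.

Definition pair_here (p : vtag * vtag) : numeric V2 :=
  And (tag_form ord0 p.1) (tag_form ord_max p.2).

Definition guard p := And (pair_here p) (nconst V2 (~~ is_numeric p)).

Definition edge_form : pform sigma V2 :=
  PForm (nany [seq And (pair_here p)
                       (if pair_form p is inl a then a else nconst V2 false)
              | p <- enum {: vtag * vtag}])
        [seq (guard p, pair_literal p) | p <- enum {: vtag * vtag}].

Section Tags.
Variables (n : nat) (n_gt1 : 1 < n) (x : V2 -> 'I_n).

Definition tag_of a := decode (fun t => x (tag_var a t) != 0 :> nat).
Local Notation here := (tag_of ord0, tag_of ord_max).

Lemma nsat_here p : nsat n_gt1 (pair_here p) x = (p == here).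
Proof. by rewrite nsat_and !nsat_tag -xpair_eqE -surjective_pairing eq_sym. Qed.

Lemma nsat_guard p :
  nsat n_gt1 (guard p) x = (p == here) && ~~ is_numeric p.
Proof. by rewrite nsat_and nsat_here nsat_const. Qed.

Lemma has_here (Q : pred (vtag * vtag)) :
  has (fun p => (p == here) && Q p) (enum {: vtag * vtag}) = Q here.
Proof.
apply/hasP/idP => [[p _ /andP[/eqP -> //]]|Qh].
by exists here; rewrite ?mem_enum ?eqxx.
Qed.

Lemma nsat_alpha0 : nsat n_gt1 (alpha0 edge_form) x =
  if pair_form here is inl a then nsat n_gt1 a x else false.
Proof.
rewrite nsat_any has_map -[RHS](has_here (fun p =>
  if pair_form p is inl a then nsat n_gt1 a x else false)).
apply: eq_has => p; rewrite [LHS]nsat_and nsat_here; congr andb.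
by case: pair_form => // l; rewrite nsat_const.
Qed.

End Tags.

(** Two vertices have exactly one pair of tags, and [alpha0] is false when that pair calls for a
    literal. *)
Lemma edge_form_exclusive : exclusive edge_form.
Proof.
move=> n n_gt1 x.
have -> : unzip1 (cases edge_form) = map guard (enum {: vtag * vtag}).
  by rewrite /unzip1 -map_comp.
rewrite pairwise_cons pairwise_map all_map; apply/andP; split.
  apply/allP => p _; apply/negP => /andP[].
  by rewrite nsat_alpha0 nsat_guard /is_numeric => + /andP[/eqP ->]; case: pair_form.
have := enum_uniq {: vtag * vtag}; rewrite uniq_pairwise; apply: sub_pairwise.
move=> p q pq; apply/negP => /andP[]; rewrite !nsat_guard.
by move=> /andP[/eqP pE _] /andP[/eqP qE _]; rewrite /= pE qE eqxx in pq.
Qed.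

Lemma edge_formP (A : STRUC sigma) (x : V2 -> 'I_(usize A)) :
  psat edge_form x =
  adj fm chd p0 xv
    (tag_of x ord0, env_of x (env_var ord0), x (wit_var ord0))
    (tag_of x ord_max, env_of x (env_var ord_max), x (wit_var ord_max)).
Proof.
rewrite -nadjP /psat nsat_alpha0 has_map.
rewrite (eq_has (a2 := fun p => (p == (tag_of x ord0, tag_of x ord_max)) &&
  (~~ is_numeric p && lsat (A := A) (pair_literal p) x))); last first.
  by move=> p; rewrite andbA -(nsat_guard (usize_gt1 A)).
rewrite has_here /is_numeric /pair_literal /pair_form /=.
by case: nadj => //= a; rewrite orbF.
Qed.

Local Notation dim := #|coord|.

Definition all_tuples : numeric 'I_dim := nconst 'I_dim true.

Lemma card_all_tuples n (n_gt1 : 1 < n) :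
  #|fop_dom all_tuples n_gt1| = n ^ dim.
Proof.
transitivity #|{: dim.-tuplelexi 'I_n}|; last by rewrite card_tuple card_ord.
by apply: eq_card => b; rewrite unfold_in /fop_dom nsat_const.
Qed.

Lemma all_tuples_gt1 n (n_gt1 : 1 < n) : 1 < #|fop_dom all_tuples n_gt1|.
Proof.
rewrite card_all_tuples (leq_trans n_gt1) // -{1}[n]expn1.
(* The witness coordinate makes the dimension positive. *)
by rewrite leq_exp2l // (cardD1 (inr tt : coord)).
Qed.

Definition graph_fop : fop sigma sigma_g :=
  @Fop sigma sigma_g dim all_tuples (fun _ => edge_form)
    (fun c : void => match c with end) all_tuples_gt1
    (fun _ => edge_form_exclusive) (fun c : void => match c with end)
    (fun _ (c : void) => match c with end).

Section Image.
Variable A : STRUC sigma.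
Local Notation G := (fop_map graph_fop A).

Definition coord_val (u : 'I_(usize G)) (c : coord) : 'I_(usize A) :=
  tnth (Order.enum_val u) (enum_rank c).

Definition vertex_of (u : 'I_(usize G)) : vertex ex W P A :=
  (decode (fun t => coord_val u (inl (inl t)) != 0 :> nat),
   [ffun j => coord_val u (inl (inr j))], coord_val u (inr tt)).

Lemma edge_graph_fop u v :
  @edge G u v = adj fm chd p0 xv (vertex_of u) (vertex_of v).
Proof. exact: edge_formP. Qed.

Lemma vertex_of_onto (v : vertex ex W P A) : exists u, vertex_of u = v.
Proof.
case: v => [[t e] w].
pose b : dim.-tuplelexi 'I_(usize A) := [tuple match enum_val i with
  | inl (inl t') => if t' == t then oneU A else zeroU A
  | inl (inr j) => e j
  | inr tt => w end | i < dim].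
have bin : b \in fop_dom all_tuples (usize_gt1 A).
  by rewrite unfold_in /fop_dom nsat_const.
exists (Order.enum_rank_in bin b).
have bE c : coord_val (Order.enum_rank_in bin b) c = match c with
  | inl (inl t') => if t' == t then oneU A else zeroU A
  | inl (inr j) => e j
  | inr tt => w end.
  by rewrite /coord_val Order.enum_rankK_in // tnth_mktuple enum_rankK.
rewrite /vertex_of bE; congr (_, _, _); last first.
  by apply/ffunP => j; rewrite ffunE bE.
rewrite /decode; case: pickP => [t'|/(_ t)] /=; rewrite bE.
  by case: (t' =P t) => [->|].
by rewrite eqxx.
Qed.

Lemma simple_graph_fop : simple_graph G.
Proof.
by split=> [u v|u]; rewrite !edge_graph_fop; [exact: adj_sym|exact: adj_irr].
Qed.

Lemma graph_fop_colorable : clique_colorable (@edge G) <->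
  clique_colorable (@adj sigma ex al W P fm chd p0 xv A).
Proof.
have [s sK] := choice vertex_of_onto.
apply: (clique_colorable_blowup sK); [exact: adj_irr|exact: edge_graph_fop].
Qed.

End Image.

End Definability.

(** * Translation of second-order sentences *)

Section Translation.
Variables (sigma : vocab) (ex al : relsig) (L N : nat).
Local Notation Sigma := (extend (extend sigma ex) al).

(* The input constants and 0, 1, max, as [inr None], [inr (Some false)] and
   [inr (Some true)]. *)
Definition special : finType := (csts sigma + option bool)%type.

(* Variables for the special elements, for the quantifiers by depth, for
   arguments of existential relations, and unused ones that pad the graph. *)
Definition wvar : finType :=
  ((special + 'I_L.+1) + ('I_N.+1 + {R : rsym ex & 'I_(arity R)}))%type.

Local Notation form := (fml sigma ex al wvar).

Definition spec_var (s : special) : wvar := inl (inl s).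
Definition quant_var (d : nat) : wvar := inl (inr (inord d)).
Definition dummy : wvar := inr (inl ord0).

Definition arg_vars (R : rsym ex) : (arity R).-tuple wvar :=
  map_tuple (fun i => inr (inr (Tagged (fun R : rsym ex => 'I_(arity R)) i)))
    (ord_tuple (arity R)).

Lemma arg_vars_uniq R : uniq (arg_vars R).
Proof.
rewrite map_inj_uniq ?val_ord_tuple ?enum_uniq // => i j.
pose T (R : rsym ex) := 'I_(arity R).
move/(congr1 (fun x : wvar => if x is inr (inr u) then u else Tagged T i)).
by move/eqP; rewrite eq_Tagged => /eqP.
Qed.

(** Second-order atoms of [fml] take only variables, so the special elements are named by variables
    which these atoms pin down. *)
Definition spec_atom (s : special) : form :=
  let x := Var vocab0 (spec_var s) in
  match s with
  | inl c => FIn (Literal true (LEq (inl (spec_var s)) (inr c)))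
  | inr None => FNum (Eq x (Zero _ _))
  | inr (Some false) => FNum (Eq x (One _ _))
  | inr (Some true) => FNum (Eq x (Max _ _))
  end.

Definition term_var (V : Type) (rho : V -> wvar) (t : term Sigma V) : wvar :=
  match t with
  | Var v => rho v
  | Cst c => spec_var (inl c)
  | Zero => spec_var (inr None)
  | One => spec_var (inr (Some false))
  | Max => spec_var (inr (Some true))
  end.

Definition bind_var (V : Type) (rho : V -> wvar) (d : nat) (o : option V) : wvar :=
  if o is Some v then rho v else quant_var d.

(** Binding [dummy], which no translated term uses, turns [Nor] into a propositional connective. *)
Definition FNot (f : form) : form := Nor dummy f f.

Fixpoint depth sg (V : Type) (f : fo sg V) : nat :=
  match f with
  | Not f => depth f
  | And f g | Or f g => maxn (depth f) (depth g)
  | Ex f | All f => (depth f).+1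
  | _ => 0
  end.

Fixpoint translate (V : Type) (f : fo Sigma V) (rho : V -> wvar) (d : nat) : form :=
  let x t := Var vocab0 (term_var rho t) in
  match f with
  | Eq s t => FNum (Eq (x s) (x t))
  | Le s t => FNum (Le (x s) (x t))
  | Bit s t => FNum (Bit (x s) (x t))
  | Plus s t u => FNum (Plus (x s) (x t) (x u))
  | Times s t u => FNum (Times (x s) (x t) (x u))
  | Suc s t => FNum (Suc (x s) (x t))
  | Rel R ts =>
    match R return (@arity (rels Sigma) R).-tuple (term Sigma V) -> form with
    | inl (inl R) => fun ts => FIn (Literal true
        (@LRel sigma _ R (map_tuple (fun t => inl (term_var rho t)) ts)))
    | inl (inr R) => fun ts => FEx R (map_tuple (term_var rho) ts)
    | inr R => fun ts => FAll R (map_tuple (term_var rho) ts)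
    end ts
  | Not f => FNot (translate f rho d)
  | And f g => Nor dummy (FNot (translate f rho d)) (FNot (translate g rho d))
  | Or f g => FNot (Nor dummy (translate f rho d) (translate g rho d))
  | Ex f => let f' := translate f (bind_var rho d) d.+1 in
            FNot (Nor (quant_var d) f' f')
  | All f => let f' := FNot (translate f (bind_var rho d) d.+1) in
             Nor (quant_var d) f' f'
  end.

(** This is a relativised universal quantifier: for every value of the variable of [s], the pinning
    atom implies [f]. Exactly one value satisfies the atom. *)
Definition bind_special (s : special) (f : form) : form :=
  let f' := Nor dummy (FNot (spec_atom s)) f in Nor (spec_var s) f' f'.

(** The double negation keeps the truth value and puts a [Nor] at the root, as the graph
    requires. *)
Definition closed_translation (f : fo Sigma void) : form :=
  FNot (FNot (foldr bind_special (translate f (of_void wvar) 0) (enum special))).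

Section Semantics.
Variables (A : STRUC sigma) (X : relint ex (usize A)) (Y : relint al (usize A)).
Local Notation n := (usize A).
Local Notation env := {ffun wvar -> 'I_n}.
Local Notation B := (expand (A := expand X) Y).

Definition spec_val (s : special) : 'I_n :=
  match s with
  | inl c => cstv A c
  | inr None => zeroU A
  | inr (Some false) => oneU A
  | inr (Some true) => maxU A
  end.

Definition spec_ok (e : env) : Prop := forall s, e (spec_var s) = spec_val s.

(** Depths stop at [L] because [inord] is only faithful up to there: beyond [L] it returns 0. *)
Definition fresh (V : Type) (rho : V -> wvar) (d : nat) : Prop :=
  forall v, rho v <> dummy /\ forall j, d <= j <= L -> rho v <> quant_var j.

Definition expresses (f : form) (V : Type) (rho : V -> wvar)
    (S : (V -> 'I_n) -> bool) : Prop :=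
  forall e, spec_ok e -> fsat X Y f e = S (e \o rho).

Lemma fsat_nor i f g (e : env) : fsat X Y (Nor i f g) e =
  ~~ [exists x, fsat X Y f (upd e i x) || fsat X Y g (upd e i x)].
Proof. by []. Qed.

Lemma fsat_dummy f g e bf bg :
  (forall x, fsat X Y f (upd e dummy x) = bf) ->
  (forall x, fsat X Y g (upd e dummy x) = bg) ->
  fsat X Y (Nor dummy f g) e = ~~ (bf || bg).
Proof.
move=> fb gb /=; congr negb; apply/existsP/idP => [[x]|bfg].
  by rewrite fb gb.
by exists (zeroU A); rewrite fb gb.
Qed.

Lemma expresses_nor f g (V : Type) (rho : V -> wvar) d S T : fresh rho d ->
  expresses f rho S -> expresses g rho T ->
  expresses (Nor dummy f g) rho (fun x => ~~ (S x || T x)).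
Proof.
move=> rhoF fS gT e eok.
have eE x : upd e dummy x \o rho = e \o rho.
  by apply: funext => v; rewrite /= ffunE; case: eqP => // /(rhoF v).1.
by apply: fsat_dummy => x; rewrite ?fS ?gT ?eE // => s; rewrite ffunE eok.
Qed.

Lemma expresses_not f (V : Type) (rho : V -> wvar) d S : fresh rho d ->
  expresses f rho S -> expresses (FNot f) rho (fun x => ~~ S x).
Proof.
move=> rhoF fS e eok; rewrite (expresses_nor rhoF fS fS) //.
by rewrite orbb.
Qed.

Lemma expresses_exists f (V : Type) (rho : V -> wvar) d S : fresh rho d -> d <= L ->
  expresses f (bind_var rho d) S ->
  expresses (Nor (quant_var d) f f) rho
    (fun e => ~~ [exists x, S (econs (A := B) x e)]).
Proof.
move=> rhoF dL fS e eok /=; congr negb; apply: eq_existsb => x.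
rewrite orbb fS => [|s]; last by rewrite ffunE eok.
congr (S _); apply: funext => -[v|] /=; rewrite ffunE ?eqxx //.
by case: eqP => // /((rhoF v).2 d); rewrite leqnn dL => /(_ isT).
Qed.

Lemma fresh_bind (V : Type) (rho : V -> wvar) d : fresh rho d -> d <= L ->
  fresh (bind_var rho d) d.+1.
Proof.
move=> rhoF dL [v|] /=; last first.
  split=> // j /andP[dj jL] [] /(congr1 val).
  by rewrite /= !inordK // => E; rewrite E ltnn in dj.
split=> [|j /andP[dj jL]]; first exact: (rhoF v).1.
by apply: (rhoF v).2; rewrite (ltnW dj).
Qed.

Lemma term_varE (V : Type) (rho : V -> wvar) (e : env) (t : term Sigma V) :
  spec_ok e -> e (term_var rho t) = teval (A := B) (e \o rho) t.
Proof.
move=> eok; case: t => [v|c|||] //.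
- exact: (eok (inl c)).
- exact: (eok (inr None)).
- exact: (eok (inr (Some false))).
- rewrite [LHS](eok (inr (Some true))); exact/val_inj.
Qed.

Lemma translate_expresses (V : Type) (f : fo Sigma V) (rho : V -> wvar) d :
  fresh rho d -> d + depth f <= L ->
  expresses (translate f rho d) rho (sat (A := B) f).
Proof.
elim: f rho d => {V} [V s t|V s t|V s t|V s t u|V s t u|V s t|V R ts|V f IH|
    V f IHf g IHg|V f IHf g IHg|V f IH|V f IH] rho d rhoF /= dL;
  try by move=> e eok; rewrite /= /nsat /= -!term_varE.
- case: R ts => [[R|R]|R] ts e eok; rewrite /= /lsat /= ?eqb_id.
  + rewrite eq_sym eqb_id; congr relv; apply: eq_from_tnth => i.
    by rewrite !tnth_map /= -term_varE.
  + by congr X; apply: eq_from_tnth => i; rewrite !tnth_map -term_varE.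
  + by congr Y; apply: eq_from_tnth => i; rewrite !tnth_map -term_varE.
- exact: expresses_not (IH _ _ rhoF dL).
- have fL : d + depth f <= L by apply: leq_trans dL; rewrite leq_add2l leq_maxl.
  have gL : d + depth g <= L by apply: leq_trans dL; rewrite leq_add2l leq_maxr.
  move=> e eok; have fN := expresses_not rhoF (IHf _ _ rhoF fL).
  rewrite (expresses_nor rhoF fN (expresses_not rhoF (IHg _ _ rhoF gL))) //.
  by rewrite negb_or !negbK.
- have fL : d + depth f <= L by apply: leq_trans dL; rewrite leq_add2l leq_maxl.
  have gL : d + depth g <= L by apply: leq_trans dL; rewrite leq_add2l leq_maxr.
  move=> e eok; have fg := expresses_nor rhoF (IHf _ _ rhoF fL) (IHg _ _ rhoF gL).
  by rewrite (expresses_not rhoF fg) // negbK.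
- rewrite addnS -addSn in dL; have d_leL : d <= L.
    by rewrite (leq_trans _ dL) // ltnW // leq_addr.
  have fb := IH _ _ (fresh_bind rhoF d_leL) dL.
  move=> e eok; rewrite (expresses_not rhoF (expresses_exists rhoF d_leL fb)) //.
  by rewrite negbK.
- rewrite addnS -addSn in dL; have d_leL : d <= L.
    by rewrite (leq_trans _ dL) // ltnW // leq_addr.
  have bF := fresh_bind rhoF d_leL.
  have fb := expresses_not bF (IH _ _ bF dL).
  move=> e eok; rewrite (expresses_exists rhoF d_leL fb) //.
  by rewrite negb_exists; apply: eq_forallb => x; rewrite negbK.
Qed.

Lemma fsat_spec_atom s (e : env) :
  fsat X Y (spec_atom s) e = (e (spec_var s) == spec_val s).
Proof. by case: s => [c|[[]|]] //=; rewrite /lsat /= eq_sym eqb_id. Qed.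

(** [l] lists the special elements still to be bound; the variables of the others must already be
    right in [e]. *)
Lemma fsat_bind_special f b (l : seq special) (e : env) :
  (forall e, spec_ok e -> fsat X Y f e = b) ->
  (forall s, s \notin l -> e (spec_var s) = spec_val s) ->
  fsat X Y (foldr bind_special f l) e = b.
Proof.
move=> fb; elim: l e => [|s l IH] e el; first by apply: fb => s; exact: el.
set g := foldr _ _ _ in IH *.
have gE x : fsat X Y (Nor dummy (FNot (spec_atom s)) g) (upd e (spec_var s) x) =
    (x == spec_val s) && ~~ b.
  have atomE y z : fsat X Y (spec_atom s)
      (upd (upd (upd e (spec_var s) x) dummy y) dummy z) = (x == spec_val s).
    by rewrite fsat_spec_atom !ffunE /= !eqxx.
  have notE y : fsat X Y (FNot (spec_atom s))
      (upd (upd e (spec_var s) x) dummy y) = (x != spec_val s).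
    by rewrite (fsat_dummy (atomE y) (atomE y)) orbb.
  have [xs|/negPf xs] := eqVneq x (spec_val s).
    apply: (fsat_dummy (bf := false)) => y; first by rewrite notE xs eqxx.
    apply: IH => s' s'l; rewrite !ffunE /=; case: eqP => [[->]//|/eqP ss'].
    by apply: el; rewrite inE negb_or s'l andbT; apply: contraNneq ss' => ->.
  apply/negbTE; rewrite negbK; apply/existsP; exists (zeroU A).
  by apply/orP; left; apply: etrans (notE _) (negbT xs).
apply: etrans (fsat_nor (spec_var s) (Nor dummy (FNot (spec_atom s)) g)
  (Nor dummy (FNot (spec_atom s)) g) e) _.
under eq_existsb => x do rewrite orbb gE.
by apply/existsPn/idP => [/(_ (spec_val s))|-> x]; rewrite ?eqxx ?andbF ?negbK.
Qed.

Lemma fsat_closed_translation f e : depth f <= L ->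
  fsat X Y (closed_translation f) e = sat (A := B) f (of_void 'I_n).
Proof.
move=> fL; set b := sat _ _.
have wE e' : fsat X Y (foldr bind_special (translate f (of_void wvar) 0)
    (enum special)) e' = b.
  apply: fsat_bind_special => [e'' eok|s]; last by rewrite mem_enum.
  rewrite (@translate_expresses _ f (of_void wvar) 0) //.
  by congr sat; apply: funext; case.
have nE e' := fsat_dummy (fun x => wE (upd e' dummy x)) (fun x => wE (upd e' dummy x)).
rewrite (fsat_dummy (fun x => nE (upd e dummy x)) (fun x => nE (upd e dummy x))).
by rewrite !orbb negbK.
Qed.

End Semantics.

End Translation.

(** * Hardness of the truncations *)

Lemma TwoCCcE (G : STRUC sigma_g) :
  TwoCCc G <-> simple_graph G /\ ~ clique_colorable (@edge G).
Proof.
by split=> -[simG nc]; split=> // H; apply: nc; apply/two_clique_coloringE.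
Qed.

Lemma trunc_TwoCCc_hard (N : nat) (sigma : vocab) (S : problem sigma) :
  Pi2p S -> fop_reducible S (trunc TwoCCc N).
Proof.
move=> [Phi ->]; set L := depth (matrix Phi).
have [P [fm [chd [p0 [p0E chdP]]]]] :=
  fml_nodes (closed_translation L N (matrix Phi)).
exists (graph_fop fm chd p0 (@arg_vars sigma _ L N)) => A.
set G := fop_map _ A.
have simG : simple_graph G by exact: simple_graph_fop.
have bigG : N <= usize G.
  have -> : usize G = usize A ^ #|coord (exrels Phi) (wvar sigma (exrels Phi) L N) P|.
    exact: card_all_tuples.
  (* A power of a base above 1 exceeds its exponent, and the padding variables bring the dimension
     above [N]. The image is thus too large for the truncation to add it. *)
  apply: leq_trans (ltnW (ltn_expl _ (usize_gt1 A))).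
  pose pad (i : 'I_N.+1) : coord (exrels Phi) (wvar sigma (exrels Phi) L N) P :=
    inl (inr (inr (inl i))).
  have padI : injective pad by move=> i j [].
  by rewrite ltnW // -[X in X <= _]card_ord; exact: leq_card padI.
have colG : clique_colorable (@edge G) <-> models A Phi.
  apply: (iff_trans (graph_fop_colorable _ _ _ _ _)).
  have p0N : exists i f g, fm p0 = Nor i f g by rewrite p0E; do 3!eexists.
  apply: (iff_trans (clique_colorable_modelsE A chdP p0N (@arg_vars_uniq sigma _ L N))).
  split=> -[X XP]; exists X => Y.
    by have [e] := XP Y; rewrite p0E fsat_closed_translation.
  by exists [ffun=> zeroU A]; rewrite p0E fsat_closed_translation.
split=> [nA|[/TwoCCcE[_ nG] /colG//|]]; last by rewrite /= ltnNge bigG.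
by left; apply/TwoCCcE; split=> // /colG.
Qed.

(** * Membership and universality *)

Section Membership.
Variable N : nat.

Definition unary_sig : relsig := @RelSig unit (fun=> 1).
Local Notation Sigma := (extend (extend sigma_g unary_sig) unary_sig).

Definition fEdge (V : Type) (x y : term Sigma V) : fo Sigma V :=
  @Rel Sigma V (inl (inl tt)) [tuple x; y].

Definition fColour (V : Type) (x : term Sigma V) : fo Sigma V :=
  @Rel Sigma V (inl (inr tt)) [tuple x].

Definition fClique (V : Type) (x : term Sigma V) : fo Sigma V :=
  @Rel Sigma V (inr tt) [tuple x].

(* The element [t] + k exists. *)
Fixpoint fLarge (k : nat) (V : Type) (t : term Sigma V) : fo Sigma V :=
  if k is k'.+1 then
    Ex (And (Suc (match t with
                  | Var v => Var Sigma (Some v) | Cst c => Cst _ c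
                  | Zero => Zero _ _ | One => One _ _ | Max => Max _ _ end)
                 (Var Sigma None))
            (fLarge k' (Var Sigma (@None V))))
  else Eq t t.

Definition x2 : term Sigma (option (option void)) := Var Sigma (Some None).
Definition y2 : term Sigma (option (option void)) := Var Sigma None.

Definition fSimple : fo Sigma void :=
  All (All (And (Not (fEdge y2 y2)) (Or (Not (fEdge x2 y2)) (fEdge y2 x2)))).

Definition fMaximal : fo Sigma void :=
  And (All (All (Or (Not (And (fClique x2) (fClique y2)))
                    (Or (Eq x2 y2) (fEdge x2 y2)))))
      (All (Ex (And (fClique y2) (Not (fEdge x2 y2))))).

Definition fBichromatic : fo Sigma void :=
  Ex (Ex (And (And (fClique x2) (fClique y2))
              (And (fColour x2) (Not (fColour y2))))).

(** This defines the complement of the truncation, since [Pi2p] negates the sentence; structures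
    that are not simple graphs belong to it when large. The element [N.-1] exists exactly when there
    are at least [N] elements, for positive [N]. *)
Definition not_TwoCCc : sosent sigma_g :=
  @SOSent sigma_g unary_sig unary_sig
    (And (fLarge N.-1 (Zero Sigma void))
         (Or (Not fSimple) (Or (Not fMaximal) fBichromatic))).

Variables (G : STRUC sigma_g) (X Y : relint unary_sig (usize G)).
Local Notation B := (expand (A := expand X) Y).
Local Notation sat f := (sat (A := B) f).

Lemma sat_large k (V : Type) (t : term Sigma V) (e : V -> 'I_(usize G)) :
  sat (fLarge k t) e = (teval (A := B) e t + k < usize G).
Proof.
elim: k V t e => [|k IH] V t e /=; first by rewrite eqxx addn0 ltn_ord.
set t' := match t with Var _ => _ | _ => _ end.
have t'E x : teval (A := B) (econs x e) t' = teval (A := B) e t by rewrite /t'; case: (t).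
apply/existsP/idP => [[x]|kG].
  by rewrite t'E IH /= => /andP[/eqP <-]; rewrite addSnnS.
have tG : (teval (A := B) e t).+1 < usize G.
  by apply: leq_ltn_trans kG; rewrite -addn1 leq_add2l.
by exists (Ordinal tG); rewrite t'E IH /= eqxx addSnnS.
Qed.

Definition clique_set : {set 'I_(usize G)} := [set v | Y (R := tt) [tuple v]].
Definition colour_of (v : 'I_(usize G)) : bool := X (R := tt) [tuple v].

Lemma sat_fEdge (V : Type) (x y : term Sigma V) (e : V -> 'I_(usize G)) :
  sat (fEdge x y) e = @edge G (teval (A := B) e x) (teval (A := B) e y).
Proof. by rewrite /edge /=; congr relv; exact/val_inj. Qed.

Lemma sat_fColour (V : Type) (x : term Sigma V) (e : V -> 'I_(usize G)) :
  sat (fColour x) e = colour_of (teval (A := B) e x).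
Proof. by rewrite /colour_of /=; congr X; exact/val_inj. Qed.

Lemma sat_fClique (V : Type) (x : term Sigma V) (e : V -> 'I_(usize G)) :
  sat (fClique x) e = (teval (A := B) e x \in clique_set).
Proof. by rewrite inE /=; congr Y; exact/val_inj. Qed.

Lemma sat_and (V : Type) (f g : fo Sigma V) e :
  sat (And f g) e = sat f e && sat g e.
Proof. by []. Qed.

Lemma sat_or (V : Type) (f g : fo Sigma V) e :
  sat (Or f g) e = sat f e || sat g e.
Proof. by []. Qed.

Lemma sat_not (V : Type) (f : fo Sigma V) e : sat (Not f) e = ~~ sat f e.
Proof. by []. Qed.

Lemma sat_eq (V : Type) (x y : term Sigma V) e :
  sat (Eq x y) e = (teval (A := B) e x == teval (A := B) e y).
Proof. by []. Qed.

Lemma sat_allP (V : Type) (f : fo Sigma (option V)) e :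
  reflect (forall x, sat f (econs (A := B) x e)) (sat (All f) e).
Proof. exact: forallP. Qed.

Lemma sat_exP (V : Type) (f : fo Sigma (option V)) e :
  reflect (exists x, sat f (econs (A := B) x e)) (sat (Ex f) e).
Proof. exact: existsP. Qed.

Definition satE :=
  (sat_and, sat_or, sat_not, sat_eq, sat_fEdge, sat_fColour, sat_fClique).

Lemma sat_fSimple e : reflect (simple_graph G) (sat fSimple e).
Proof.
apply: (iffP (sat_allP _ _)) => [H|[Gsym Girr] u].
  have {}H u v := sat_allP _ _ (H u) v.
  split=> [u v|u]; last first.
    by have := H u u; rewrite !satE /= => /andP[/negPf].
  have := H u v; have := H v u; rewrite !satE /=.
  by case: (edge u v); case: (edge v u) => //=; rewrite ?andbF.
apply/sat_allP => v; rewrite !satE /= Girr Gsym.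
by case: edge.
Qed.

Lemma sat_fMaximal e : reflect (mclique (@edge G) clique_set) (sat fMaximal e).
Proof.
rewrite sat_and; apply: (iffP andP) => -[cl mx]; split.
- move=> u v uK vK uv; have := sat_allP _ _ (sat_allP _ _ cl u) v.
  by rewrite !satE /= uK vK (negPf uv).
- move=> v; have /sat_exP[u] := sat_allP _ _ mx v.
  by rewrite !satE /= => /andP[]; exists u.
- apply/sat_allP => u; apply/sat_allP => v; rewrite !satE /=.
  have [//|uv] := eqVneq u v; first by rewrite orbT.
  by case: (boolP (_ \in _)) => //= uK; case: (boolP (_ \in _)) => //= vK; exact: cl.
- apply/sat_allP => v; have [u uK uv] := mx v; apply/sat_exP; exists u.
  by rewrite !satE /= uK uv.
Qed.

Lemma sat_fBichromatic e : reflect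
  (exists u v, [/\ u \in clique_set, v \in clique_set & colour_of u != colour_of v])
  (sat fBichromatic e).
Proof.
apply: (iffP (sat_exP _ _)) => [[u /sat_exP[v]]|[u [v [uK vK uv]]]].
  rewrite !satE /= => /andP[/andP[uK vK] uv].
  by exists u, v; split=> //; case: (colour_of u) (colour_of v) uv => [] [].
(* The formula wants the vertex of colour true first. *)
wlog cu : u v uK vK uv / colour_of u => [H|].
  have [cu|/negPf cu] := boolP (colour_of u); first exact: (H u v).
  by apply: (H v u) => //; [rewrite eq_sym|move: uv; rewrite cu; case: colour_of].
exists u; apply/sat_exP; exists v.
by rewrite !satE /= uK vK cu; move: uv; rewrite cu; case: colour_of.
Qed.

Lemma sat_not_TwoCCc e : 0 < N -> reflect
  (N <= usize G /\ (simple_graph G -> mclique (@edge G) clique_set ->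
    exists u v, [/\ u \in clique_set, v \in clique_set
                  & colour_of u != colour_of v]))
  (sat (matrix not_TwoCCc) e).
Proof.
move=> N_gt0.
have largeE : sat (fLarge N.-1 (Zero Sigma void)) e = (N <= usize G).
  by rewrite sat_large /= add0n prednK.
rewrite sat_and largeE.
apply: (iffP andP) => -[NG H]; split=> //.
  move=> simG mK; move: H; rewrite !sat_or !sat_not (introT (sat_fSimple _) simG).
  by rewrite (introT (sat_fMaximal _) mK) => /sat_fBichromatic.
rewrite !sat_or !sat_not.
case: sat_fSimple => [simG|//]; case: sat_fMaximal => [mK|//].
by rewrite [~~ true]/= !orFb; apply/(sat_fBichromatic e); exact: H.
Qed.

End Membership.

Lemma trunc_TwoCCc_Pi2p (N : nat) : 0 < N -> Pi2p (trunc TwoCCc N).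
Proof.
move=> N_gt0; exists (not_TwoCCc N); apply: funext => G; apply: propext.
have modelsE : models G (not_TwoCCc N) <->
    N <= usize G /\ (simple_graph G -> clique_colorable (@edge G)).
  split=> [[X XP]|[NG colG]].
    have XY Y := elimT (@sat_not_TwoCCc N G X Y _ N_gt0) (XP Y).
    split=> [|simG]; first by case: (XY (fun R _ => true)).
    exists (colour_of X) => K mK.
    pose Y : relint unary_sig (usize G) :=
      fun R (t : (arity R).-tuple _) => thead (t : 1.-tuple _) \in K.
    have KE : clique_set Y = K by apply/setP => v; rewrite inE.
    by have [_ /(_ simG)] := XY Y; rewrite KE; apply.
  have [simG|nsimG] := pselect (simple_graph G); last first.
    by exists (fun R _ => true) => Y; apply/sat_not_TwoCCc.
  have [c cP] := colG simG.
  pose X : relint unary_sig (usize G) :=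
    fun R (t : (arity R).-tuple _) => c (thead (t : 1.-tuple _)).
  exists X => Y.
  by apply/(@sat_not_TwoCCc N G X Y _ N_gt0); split=> // _; exact: cP.
split=> [[/TwoCCcE[simG ncol] /modelsE[_ /(_ simG)]//|]|nm].
  by rewrite /= ltnNge => /negP NG /modelsE[].
have [NG|NG] := leqP N (usize G); last by right.
left; apply/TwoCCcE; have [simG|nsimG] := pselect (simple_graph G).
  by split=> // col; apply: nm; apply/modelsE.
by case: nm; apply/modelsE.
Qed.

(* Two endpoints for each of the [t] literals leave a vertex to isolate. *)
Lemma trunc_TwoCCc_universal (t : nat) :
  universal (t.*2.+2) t (trunc TwoCCc t.*2.+2).
Proof.
move=> m tm L [m_gt1 [E [[Esym Eirr] EL]]].
pose used (v : 'I_m) := v \in map (fun l => l.1.2) L ++ map snd L.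
have [z zfree] : exists z, ~~ used z.
  apply/existsP; rewrite -negb_forall; apply/negP => /forallP allused.
  set s := _ ++ _ in used allused.
  have : 'I_m \subset s by apply/subsetP => v _; exact: allused.
  move=> /subset_leq_card/leq_trans/(_ (card_size s)); rewrite card_ord.
  rewrite size_cat !size_map size_tuple addnn leqNgt.
  by rewrite (leq_trans _ tm).
(* Deleting the edges at [z] affects no literal, as [z] is not an endpoint of any. *)
pose E' : relint (rels sigma_g) m := fun R (p : 2.-tuple 'I_m) =>
  [&& E tt p, tnth p ord0 != z & tnth p ord_max != z].
pose G := @Struc sigma_g m m_gt1 E' (of_void _).
have GE u v : @edge G u v =
    [&& @edge (@Struc sigma_g m m_gt1 E (of_void _)) u v, u != z & v != z].
  by [].
exists m_gt1, E'; split.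
  left; apply/TwoCCcE; split=> [|[c cP]].
    split=> [u v|u]; last by rewrite GE Eirr.
    by rewrite !GE Esym [(v != z) && _]andbC.
  have [|u [v [/set1P -> /set1P ->]]] := cP [set z]; last by rewrite eqxx.
  split=> [u v /set1P -> /set1P ->|v]; first by rewrite eqxx.
  by exists z; rewrite ?set11 // GE eqxx !andbF.
apply/allP => -[[b u] v] lL; rewrite GE.
have -> : u != z.
  by apply: contraNneq zfree => <-; rewrite /used mem_cat (map_f (fun l => l.1.2) lL).
have -> : v != z.
  by apply: contraNneq zfree => <-; rewrite /used mem_cat (map_f snd lL) orbT.
by rewrite !andbT; exact: (allP EL _ lL).
Qed.

Theorem theorem5 : complete_universal Pi2p (truncfam TwoCCc).
Proof.
split=> [S [N /= N_gt1 <-]|].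
  split; first by apply: trunc_TwoCCc_Pi2p; exact: ltnW.
  by move=> sigma S' S'P; exact: trunc_TwoCCc_hard.
(* There are at most [k.*2] endpoints and one vertex to isolate; one more keeps the index at least 2
   when [k] is 0. *)
exists (fun k => k.*2.+2), 0 => k _; exists (trunc TwoCCc k.*2.+2); split.
- by exists k.*2.+2.
- exact: trunc_TwoCCc_universal.
- by move=> A; right.
Qed.
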